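(* Let $A\subseteq[0,1]$ be closed and let $\mathcal{R}_A$ be the class of all random vectors $(Y,\mathbf{X})\colon\Omega\to\mathbb{R}^{1+p}$, $p\in\mathbb{N}$ arbitrary, defined on $(\Omega,\mathcal{A},P)$, with $\overline{\mathrm{Ran}(F_Y)}=A$. Then the conditional convex order $\preccurlyeq_{ccx}$ on $\mathcal{R}_A$ has the following properties (all vectors $(Y,\mathbf{X}),(Y',\mathbf{X}'),(Y,(\mathbf{X},\mathbf{Z}))$ below being in $\mathcal{R}_A$): (O1) If $(Y,\mathbf{X})\stackrel{d}{=}(Y',\mathbf{X}')$, then $(Y,\mathbf{X})=_{ccx}(Y',\mathbf{X}')$. (O2) $\preccurlyeq_{ccx}$ is reflexive and transitive. (O3) $(Y,\mathbf{X})\preccurlyeq_{ccx}(Y',\mathbf{X}')$ for all $(Y',\mathbf{X}')\in\mathcal{R}_A$ if and only if $\mathbf{X}$ and $Y$ are independent. (O4) $(Y',\mathbf{X}')\preccurlyeq_{ccx}(Y,\mathbf{X})$ for all $(Y',\mathbf{X}')\in\mathcal{R}_A$ if and only if $Y$ is perfectly dependent on $\mathbf{X}$. (O5) $(Y,\mathbf{X})\preccurlyeq_{ccx}(Y,(\mathbf{X},\mathbf{Z}))$ for all $\mathbf{X},\mathbf{Z}$ and $Y$. (O6) $(Y,\mathbf{X})=_{ccx}(Y,(\mathbf{X},\mathbf{Z}))$ if and only if $Y$ and $\mathbf{Z}$ are conditionally independent given $\mathbf{X}$. (O7) $(Y,\mathbf{X})=_{ccx}(g(Y),\mathbf{h}(\mathbf{X}))$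 for every strictly increasing function $g\colon\mathbb{R}\to\mathbb{R}$ and every bijective (Borel measurable) function $\mathbf{h}$ between Euclidean spaces defined on the space in which $\mathbf{X}$ takes values. (O8) $(Y,\mathbf{X})=_{ccx}(F_Y(Y),\mathbf{X})$ and $(Y,\mathbf{X})=_{ccx}(Y,\mathbf{F}_{\mathbf{X}}(\mathbf{X}))$, where $\mathbf{F}_{\mathbf{X}}(\mathbf{X})=(F_{X_1}(X_1),\ldots,F_{X_p}(X_p))$ for $\mathbf{X}=(X_1,\ldots,X_p)$.
   Context: $(\Omega,\mathcal{A},P)$ is a non-atomic probability space. $F_Y$ is the distribution function of a real random variable $Y$, $\mathrm{Ran}(F_Y)$ its range, $\overline{\,\cdot\,}$ denotes closure, and $q_Y(v)=\inf\{y\mid F_Y(y)\ge v\}$, $v\in(0,1)$. For bounded random variables $S,T$, the convex order $S\le_{cx}T$ means $\mathbb{E}\varphi(S)\le\mathbb{E}\varphi(T)$ for all convex $\varphi\colon\mathbb{R}\to\mathbb{R}$. Conditional convex order: for random vectors $(Y,\mathbf{X})$, $(Y',\mathbf{X}')$ with $Y,Y'$ real-valued and $\mathbf{X},\mathbf{X}'$ random vectors of possibly different dimensions, $(Y,\mathbf{X})\preccurlyeq_{ccx}(Y',\mathbf{X}')$ means $P(Y\ge q_Y(v)\mid\mathbf{X})\le_{cx}P(Y'\ge q_{Y'}(v)\mid\mathbf{X}')$ for all $v\in(0,1)$. We write $=_{ccx}$ if $\preccurlyeq_{ccx}$ holds in both directions. $Y$ is perfectly dependent on $\mathbf{X}$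 if there is a measurable function $f$ with $Y=f(\mathbf{X})$ almost surely. $\stackrel{d}{=}$ denotes equality in distribution. *)

(* Defs.v *)
From HB Require Import structures.
From mathcomp Require Import all_boot all_order all_algebra.
From mathcomp Require Import all_classical all_reals all_analysis.
From mathcomp Require Import measurable_realfun.
Import Order.TTheory GRing.Theory Num.Theory.
Import numFieldNormedType.Exports.

Set Implicit Arguments.
Unset Strict Implicit.
Unset Printing Implicit Defensive.

Local Open Scope classical_set_scope.
Local Open Scope ring_scope.

Section Defs.
Context {d : measure_display} {T : measurableType d} {R : realType}.
Variable P : probability T R.

Definition nonatomic : Prop :=
  forall E : set T, measurable E -> (0 < P E)%E ->
    exists F : set T, [/\ measurable F, F `<=` E, (0 < P F)%E & (P F < P E)%E].

Definition comp_RV d1 d2 (T1 : measurableType d1) (T2 : measurableType d2)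
    (f : T1 -> T2) (mf : measurable_fun setT f) (X : {RV P >-> T1}) :
    {RV P >-> T2} :=
  HB.pack (f \o X)
    (isMeasurableFun.Build _ _ _ _ (f \o X)
       (measurableT_comp mf (measurable_funPT X))).

Lemma measurable_cat_tuple p q (X : {RV P >-> p.-tuple R})
    (Z : {RV P >-> q.-tuple R}) :
  measurable_fun setT
    (fun w => [tuple of X w ++ Z w] : (p + q).-tuple R).
Proof.
apply/measurable_fun_tnthP => i; case: (split_ordP i) => j ->.
- rewrite (_ : _ \o _ = (@tnth p R ^~ j) \o X); last first.
    by apply/funext => w /=; rewrite tnth_lshift.
  exact: (measurableT_comp (measurable_tnth j) (measurable_funPT X)).
- rewrite (_ : _ \o _ = (@tnth q R ^~ j) \o Z); last first.
    by apply/funext => w /=; rewrite tnth_rshift.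
  exact: (measurableT_comp (measurable_tnth j) (measurable_funPT Z)).
Qed.

Definition cat_RV p q (X : {RV P >-> p.-tuple R}) (Z : {RV P >-> q.-tuple R}) :
    {RV P >-> (p + q).-tuple R} :=
  HB.pack (fun w => [tuple of X w ++ Z w] : (p + q).-tuple R)
    (isMeasurableFun.Build _ _ _ _
       (fun w => [tuple of X w ++ Z w] : (p + q).-tuple R)
       (measurable_cat_tuple X Z)).

(* [cdf] takes values in [\bar R]; it is always finite. *)
Definition cdfR (Y : {RV P >-> R}) (y : R) : R := fine (cdf Y y).

Lemma measurable_cdfR (Y : {RV P >-> R}) : measurable_fun setT (cdfR Y).
Proof.
apply: nondecreasing_measurable => // x y xy.
by rewrite /cdfR fine_le ?fin_num_measure// cdf_nondecreasing.
Qed.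

Definition coord_RV p (X : {RV P >-> p.-tuple R}) (i : 'I_p) : {RV P >-> R} :=
  comp_RV (measurable_tnth i) X.

Definition cdf_tuple p (X : {RV P >-> p.-tuple R}) (x : p.-tuple R) :
    p.-tuple R :=
  [tuple cdfR (coord_RV X i) (tnth x i) | i < p].

Lemma measurable_cdf_tuple p (X : {RV P >-> p.-tuple R}) :
  measurable_fun setT (cdf_tuple X).
Proof.
apply/measurable_fun_tnthP => i.
rewrite (_ : _ \o _ = cdfR (coord_RV X i) \o (@tnth p R ^~ i)); last first.
  by apply/funext => x /=; rewrite tnth_mktuple.
exact: (measurableT_comp (measurable_cdfR _) (measurable_tnth i)).
Qed.

Definition quantile (Y : {RV P >-> R}) (v : R) : R :=
  inf [set y | v <= cdfR Y y].

(* [s] is a version of the conditional probability P(E | X).  Versions exist by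
   Radon-Nikodym and are almost surely unique. *)
Definition is_cond_prob d1 (T1 : measurableType d1) (E : set T)
    (X : {RV P >-> T1}) (s : T -> R) : Prop :=
  [/\ measurable_fun [set: g_sigma_algebra_preimageType X] s,
      P.-integrable [set: T] (EFin \o s) &
      forall B : set T1, measurable B ->
        (\int[P]_(w in X @^-1` B) (s w)%:E = P (E `&` X @^-1` B))%E].

Definition cx_le (S U : T -> R) : Prop :=
  forall phi : R -> R, convex_function [set: R^o] phi ->
    ('E_P[phi \o S] <= 'E_P[phi \o U])%E.

(* The order depends only on the laws of the conditional probabilities, so
   quantifying over all versions is the same as fixing one. *)
Definition ccx p (Y : {RV P >-> R}) (X : {RV P >-> p.-tuple R})
    p' (Y' : {RV P >-> R}) (X' : {RV P >-> p'.-tuple R}) : Prop :=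
  forall v : R, 0 < v < 1 ->
  forall s s' : T -> R,
    is_cond_prob [set w | quantile Y v <= Y w] X s ->
    is_cond_prob [set w | quantile Y' v <= Y' w] X' s' ->
    cx_le s s'.

Definition eq_ccx p (Y : {RV P >-> R}) (X : {RV P >-> p.-tuple R})
    p' (Y' : {RV P >-> R}) (X' : {RV P >-> p'.-tuple R}) : Prop :=
  ccx Y X Y' X' /\ ccx Y' X' Y X.

Definition eq_dist p (Y : {RV P >-> R}) (X : {RV P >-> p.-tuple R})
    (Y' : {RV P >-> R}) (X' : {RV P >-> p.-tuple R}) : Prop :=
  forall B : set (R * p.-tuple R), measurable B ->
    P ((fun w => (Y w, X w)) @^-1` B) = P ((fun w => (Y' w, X' w)) @^-1` B).

Definition independent d1 d2 (T1 : measurableType d1) (T2 : measurableType d2)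
    (X : {RV P >-> T1}) (Y : {RV P >-> T2}) : Prop :=
  forall (B : set T1) (C : set T2), measurable B -> measurable C ->
    (P (X @^-1` B `&` Y @^-1` C) = P (X @^-1` B) * P (Y @^-1` C))%E.

Definition cond_independent d1 d2 d3 (T1 : measurableType d1)
    (T2 : measurableType d2) (T3 : measurableType d3)
    (Y : {RV P >-> T1}) (Z : {RV P >-> T2}) (X : {RV P >-> T3}) : Prop :=
  forall (B : set T1) (C : set T2), measurable B -> measurable C ->
  forall s t u : T -> R,
    is_cond_prob (Y @^-1` B) X s ->
    is_cond_prob (Z @^-1` C) X t ->
    is_cond_prob (Y @^-1` B `&` Z @^-1` C) X u ->
    {ae P, forall w, u w = s w * t w}.

Definition perfectly_dependent p (Y : {RV P >-> R})
    (X : {RV P >-> p.-tuple R}) : Prop :=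
  exists2 f : p.-tuple R -> R,
    measurable_fun setT f & {ae P, forall w, Y w = f (X w)}.

Definition in_RA (A : set R) p (Y : {RV P >-> R})
    (X : {RV P >-> p.-tuple R}) : Prop :=
  (0 < p)%N /\ closure (range (cdfR Y)) = A.

End Defs.

Definition strictly_increasing (R : realType) (g : R -> R) : Prop :=
  {homo g : x y / x < y}.

Lemma strictly_increasing_measurable (R : realType) (g : R -> R) :
  strictly_increasing g -> measurable_fun setT g.
Proof.
by move=> gi; apply: nondecreasing_measurable => // x y; exact: ltW_homo.
Qed.

(* Main.v *)
(* Conditional probabilities given X are written f(X) with f a measurable
   function into [0, 1]; any two versions agree almost surely, so the order
   compares E phi(f(X)) for convex phi.  A subgradient of phi gives the
   conditional Jensen inequality, hence (O5) and the comparison whenever X is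
   almost surely a measurable function of the other vector; (O1) and (O2) only
   use the laws of the conditional probabilities.  The event Y >= q_Y(v) is
   v <= F_Y(Y), so it is unchanged by a strictly increasing transformation of
   Y, and its probability is determined by v and the closure of the range of
   F_Y.  In (O3), (O4) and (O6) the converse implications come from
   phi(x) = x^2: if P(E | X) and P(E | W) have the same second moment, with W
   finer than X, they are equal almost surely.  The events Y >= q_Y(v)
   approximate all rays Y > y in measure, so such identities extend to all
   events in the sigma-algebra of Y.  For (O7), an injective Borel h satisfies
   X = k(h(X)) almost surely for some Borel k; this weak form of the
   Lusin-Souslin theorem is obtained from Lusin's theorem on [0, 1].  For (O8),
   X is recovered from its distribution functions because flat pieces of F_X_i
   carry no mass. *)
Require Import Defs.
From HB Require Import structures.
From mathcomp Require Import all_boot all_order all_algebra.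
From mathcomp Require Import all_classical all_reals all_analysis.
From mathcomp Require Import measurable_realfun.
From mathcomp Require Import ring lra.
Import Order.TTheory GRing.Theory Num.Theory.
Import numFieldNormedType.Exports.

Set Implicit Arguments.
Unset Strict Implicit.
Unset Printing Implicit Defensive.

Local Open Scope classical_set_scope.
Local Open Scope ring_scope.

(** * Bounded measurable functions *)

Definition bmf d (T : measurableType d) (R : realType) (f : T -> R) :=
  measurable_fun [set: T] f /\ exists M, forall x, `|f x| <= M.

Section bounded_measurable.
Context d (T : measurableType d) (R : realType).
Implicit Types f g : T -> R.

Lemma bmf_cst (c : R) : bmf (fun _ : T => c).
Proof. by split => //; exists `|c|. Qed.

Lemma bmfD f g : bmf f -> bmf g -> bmf (fun x => f x + g x).
Proof.
move=> [mf [M fM]] [mg [N gN]]; split; first exact: measurable_funD.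
by exists (M + N) => x; rewrite (le_trans (ler_normD _ _))// lerD.
Qed.

Lemma bmfM f g : bmf f -> bmf g -> bmf (fun x => f x * g x).
Proof.
move=> [mf [M fM]] [mg [N gN]]; split; first exact: measurable_funM.
by exists (M * N) => x; rewrite normrM ler_pM.
Qed.

Lemma bmfN f : bmf f -> bmf (fun x => - f x).
Proof.
move=> [mf [M fM]]; split; first exact: measurableT_comp.
by exists M => x; rewrite normrN.
Qed.

Lemma bmfB f g : bmf f -> bmf g -> bmf (fun x => f x - g x).
Proof. by move=> ? ?; apply: bmfD => //; exact: bmfN. Qed.

Lemma bmf_norm f : bmf f -> bmf (fun x => `|f x|).
Proof.
move=> [mf [M fM]]; split; first exact: measurableT_comp.
by exists M => x; rewrite normr_id.
Qed.

Lemma bmf_indic (A : set T) : measurable A -> bmf (\1_A : T -> R).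
Proof.
move=> mA; split; first exact: measurable_indic.
by exists 1 => x; rewrite indicE; case: (_ \in _); rewrite ?normr1 ?normr0.
Qed.

Lemma bmf01 f : measurable_fun [set: T] f -> (forall x, 0 <= f x <= 1) -> bmf f.
Proof.
move=> mf f01; split => //; exists 1 => x.
by have /andP[f0 f1] := f01 x; rewrite ger0_norm.
Qed.

End bounded_measurable.

Lemma bmf_comp d1 d2 (T1 : measurableType d1) (T2 : measurableType d2)
  (R : realType) (f : T2 -> R) (X : T1 -> T2) :
  bmf f -> measurable_fun [set: T1] X -> bmf (fun w => f (X w)).
Proof.
move=> [mf [M fM]] mX; split; first exact: (measurableT_comp mf).
by exists M => x.
Qed.

(** * Real-valued expectations of bounded functions *)

Section mean.
Context d (T : measurableType d) (R : realType) (P : probability T R).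
Implicit Types f g h : T -> R.

Definition mean f : R := \int[P]_w f w.

Lemma bmf_integrable f (D : set T) : measurable D -> bmf f -> P.-integrable D (EFin \o f).
Proof.
move=> mD [mf [M fM]]; apply: (integrableS measurableT) => //.
apply: measurable_bounded_integrable => //.
  exact: le_lt_trans (probability_le1 P measurableT) (ltry _).
by exists M; split; [exact: num_real|move=> x Mx y _ /=; rewrite (le_trans (fM y))// ltW].
Qed.

Lemma meanE f : bmf f -> (mean f)%:E = (\int[P]_w (f w)%:E)%E.
Proof.
move=> bf; rewrite /mean /Rintegral fineK//.
exact: integrable_fin_num (bmf_integrable measurableT bf).
Qed.

Lemma mean_eq f g : f =1 g -> mean f = mean g.
Proof. by move=> fg; apply: eq_Rintegral => x _; exact: fg. Qed.

Lemma mean_cst (c : R) : mean (fun=> c) = c.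
Proof. by rewrite /mean Rintegral_cst// [X in fine X](probability_setT P) mulr1. Qed.

Lemma meanD f g : bmf f -> bmf g -> mean (fun x => f x + g x) = mean f + mean g.
Proof. by move=> bf bg; rewrite /mean RintegralD//; exact: bmf_integrable. Qed.

Lemma meanB f g : bmf f -> bmf g -> mean (fun x => f x - g x) = mean f - mean g.
Proof. by move=> bf bg; rewrite /mean RintegralB//; exact: bmf_integrable. Qed.

Lemma meanZ c f : bmf f -> mean (fun x => c * f x) = c * mean f.
Proof. by move=> bf; rewrite /mean RintegralZl//; exact: bmf_integrable. Qed.

Lemma le_mean f g : bmf f -> bmf g -> (forall x, f x <= g x) -> mean f <= mean g.
Proof.
by move=> bf bg fg; apply: le_Rintegral => //; exact: bmf_integrable.
Qed.

Lemma mean_ge0 f : (forall x, 0 <= f x) -> 0 <= mean f.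
Proof. by move=> f0; apply: Rintegral_ge0 => x _. Qed.

Lemma le_norm_mean f : bmf f -> `|mean f| <= mean (fun x => `|f x|).
Proof. by move=> bf; apply: le_normr_Rintegral => //; exact: bmf_integrable. Qed.

Lemma mean_indic (A : set T) : measurable A -> mean \1_A = fine (P A).
Proof. by move=> mA; rewrite /mean /Rintegral integral_indic// setIT. Qed.

Lemma mean_indicM (A B : set T) : measurable A -> measurable B ->
  mean (fun w => \1_A w * \1_B w) = fine (P (A `&` B)).
Proof.
move=> mA mB; rewrite -mean_indic; last exact: measurableI.
by apply: mean_eq => w; rewrite indicI.
Qed.

Lemma indic_ge0 (A : set T) x : 0 <= (\1_A x : R).
Proof. by rewrite indicE. Qed.

Lemma indic_le1 (A : set T) x : (\1_A x : R) <= 1.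
Proof. by rewrite indicE; case: (_ \in _). Qed.

Lemma integral_preimage_mean f (A : set T) : measurable A -> bmf f ->
  (\int[P]_(w in A) (f w)%:E = (mean (fun w => \1_A w * f w))%:E)%E.
Proof.
move=> mA bf; rewrite meanE; last by apply: bmfM => //; exact: bmf_indic.
rewrite integral_mkcond; apply: eq_integral => w _.
by rewrite patchE indicE; case: ifPn => _; rewrite ?mul1r ?mul0r.
Qed.

Lemma ae_mean_eq f g : bmf f -> bmf g -> {ae P, forall w, f w = g w} ->
  mean f = mean g.
Proof.
move=> bf bg fg; rewrite /mean /Rintegral; congr fine.
apply: ae_eq_integral => //.
- exact/measurable_EFinP/bf.1.
- exact/measurable_EFinP/bg.1.
- by apply: filterS fg => w /= -> _.
Qed.

Lemma ae_prob_eq (A B : set T) : measurable A -> measurable B ->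
  {ae P, forall w, A w <-> B w} -> P A = P B.
Proof.
move=> mA mB AB; rewrite -[LHS]fineK ?fin_num_measure//.
rewrite -[RHS]fineK ?fin_num_measure// -!mean_indic//; congr EFin.
apply: ae_mean_eq; [exact: bmf_indic|exact: bmf_indic|].
apply: filterS AB => w AB; rewrite !indicE; congr (_%:R); congr nat_of_bool.
by apply/idP/idP => /set_mem/AB/mem_set.
Qed.

Lemma mean_eq0_ae f : bmf f -> (forall x, 0 <= f x) -> mean f = 0 ->
  {ae P, forall w, f w = 0}.
Proof.
move=> bf f0 mf0.
have /ae_eq_integral_abs : measurable_fun [set: T] (EFin \o f).
  exact/measurable_EFinP/bf.1.
move=> /(_ P measurableT)[+ _].
have -> : (\int[P]_(x in [set: T]) `|(EFin \o f) x| = 0)%E.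
  rewrite -[RHS]/(0%:E) -mf0 meanE//; apply: eq_integral => x _.
  by rewrite /= ger0_norm.
by move=> /(_ erefl); apply: filterS => w /(_ I)[].
Qed.

End mean.

(** * Orthogonality to the functions of a random variable *)

Section orthogonality.
Context d d1 (T : measurableType d) (T1 : measurableType d1) (R : realType).
Variables (P : probability T R) (X : T -> T1) (h : T -> R).
Hypotheses (mX : measurable_fun [set: T] X) (bh : bmf h).

Let mpre B : measurable B -> measurable (X @^-1` B).
Proof. by move=> mB; rewrite -[X in measurable X]setTI; exact: mX. Qed.

(** The sets [B] with vanishing integral form a Dynkin system: [mean P h = 0] handles complements
    and countable additivity handles disjoint unions. It is applied to rays and to rectangles. *)
Lemma mean_preimage_dynkin (G : set (set T1)) :
  @measurable _ T1 = <<s G >> -> setI_closed G -> mean P h = 0 ->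
  (forall B, G B -> mean P (fun w => \1_(X @^-1` B) w * h w) = 0) ->
  forall B, measurable B -> mean P (fun w => \1_(X @^-1` B) w * h w) = 0.
Proof.
move=> mG GI h0 Gh B; rewrite mG.
have bI A : measurable A -> bmf (fun w => \1_(X @^-1` A) w * h w).
  by move=> mA; apply: bmfM => //; exact/bmf_indic/mpre.
apply: (@dynkin_induction _ _ G
  (fun B => mean P (fun w => \1_(X @^-1` B) w * h w) = 0)) => //.
- by rewrite preimage_setT indicT -[RHS]h0; apply: mean_eq => w; rewrite mul1r.
- move=> S mS S0; rewrite (@mean_eq _ _ _ _ _
    (fun w => h w - \1_(X @^-1` S) w * h w)).
    by rewrite meanB ?h0 ?S0 ?subr0//; exact: bI.
  by move=> w; rewrite preimage_setC !indicE in_setC; case: (_ \in _) => /=; ring.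
- move=> F mF tF F0.
  suff : (mean P (fun w => \1_(X @^-1` \bigcup_k F k) w * h w))%:E = 0%E by case.
  rewrite -integral_preimage_mean//; last exact/mpre/bigcup_measurable.
  rewrite preimage_bigcup integral_bigcup.
  + rewrite eseries0// => n _ _; rewrite integral_preimage_mean ?F0//.
    exact: mpre.
  + by move=> i j _ _ [w [Fi Fj]]; apply: tF => //; exists (X w).
  + by move=> k; exact: mpre.
  + apply: bmf_integrable => //.
    by apply: bigcup_measurable => k _; exact: mpre.
Qed.

Hypothesis X_orth : forall B, measurable B ->
  mean P (fun w => \1_(X @^-1` B) w * h w) = 0.

(* Subtracting [M / 2] times the indicator of [g >= M / 2] halves the bound
   on [g] without changing the integral against [h]. *)
Let halving (H : R) : (forall w, `|h w| <= H) ->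
  forall n M (g : T1 -> R), measurable_fun [set: T1] g -> (forall x, 0 <= g x <= M) ->
  `|mean P (fun w => g (X w) * h w)| <= M * H / 2 ^+ n.
Proof.
move=> hH; have bgh (g : T1 -> R) M : measurable_fun setT g ->
    (forall x, 0 <= g x <= M) -> bmf (fun w => g (X w) * h w).
  move=> mg gM; apply: bmfM => //; apply: (bmf_comp _ mX); split => //.
  by exists M => x; have /andP[g0 ?] := gM x; rewrite ger0_norm.
elim => [|n IH] M g mg gM.
  rewrite expr0 divr1; have bg := bgh _ _ mg gM.
  rewrite (le_trans (le_norm_mean P bg))// -[leRHS](mean_cst P).
  apply: le_mean; [exact: bmf_norm|exact: bmf_cst|move=> w].
  have /andP[g0 gM'] := gM (X w).
  by rewrite normrM ger0_norm// ler_pM.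
pose B := [set x | M / 2 <= g x].
have mB : measurable B.
  have := mg measurableT _ (measurable_itv `[M / 2, +oo[); rewrite setTI.
  by congr measurable; apply/seteqP; split => x /=; rewrite in_itv/= andbT.
pose g' x := g x - M / 2 * \1_B x.
have mg' : measurable_fun setT g'.
  by apply: measurable_funB => //; apply: measurable_funM => //; exact: measurable_indic.
have g'M x : 0 <= g' x <= M / 2.
  have /andP[g0 gM'] := gM x; rewrite /g' indicE.
  have [|] := boolP (x \in B).
    rewrite inE /B/= => ?; lra.
  rewrite notin_setE /B/= => /negP; rewrite -ltNge => ?; lra.
have -> : mean P (fun w => g (X w) * h w) = mean P (fun w => g' (X w) * h w).
  rewrite (@mean_eq _ _ _ _ (fun w => g' (X w) * h w)
    (fun w => g (X w) * h w - M / 2 * (\1_(X @^-1` B) w * h w))).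
    rewrite meanB; first rewrite meanZ ?X_orth ?mulr0 ?subr0//.
    - by apply: bmfM => //; exact/bmf_indic/mpre.
    - exact: (bgh _ M).
    - apply: bmfM; first exact: bmf_cst.
      by apply: bmfM => //; exact/bmf_indic/mpre.
  by move=> w; rewrite /g' mulrBl mulrA; congr (_ - _ * _ * _); rewrite !indicE.
rewrite (le_trans (IH _ _ mg' g'M))// exprS invfM.
by rewrite (mulrAC M) !mulrA.
Qed.

(** Iterated halving drives the integral to zero, which passes from indicators to all bounded
    functions of [X]. *)
Lemma mean_orthogonal (g : T1 -> R) : bmf g ->
  mean P (fun w => g (X w) * h w) = 0.
Proof.
move=> [mg [M gM]]; have [H hH] := bh.2.
have M0 : 0 <= M by rewrite (le_trans _ (gM point)).
have H0 : 0 <= H by rewrite (le_trans _ (hH point)).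
have h0 : mean P h = 0.
  rewrite -[RHS](X_orth measurableT); apply: mean_eq => w.
  by rewrite preimage_setT indicT mul1r.
(* Halving needs a nonnegative function; adding the constant [M] changes nothing because [h] has
   mean zero. *)
have {h0} -> : mean P (fun w => g (X w) * h w) =
    mean P (fun w => (g (X w) + M) * h w).
  have bg : bmf (fun w => g (X w)) by apply: (bmf_comp _ mX); split => //; exists M.
  rewrite [RHS](@mean_eq _ _ _ _ _ (fun w => g (X w) * h w + M * h w)).
    rewrite meanD; [|exact: bmfM|by apply: bmfM => //; exact: bmf_cst].
    by rewrite meanZ// h0 mulr0 addr0.
  by move=> w; rewrite mulrDl.
have mgM : measurable_fun setT (fun x => g x + M) by exact: measurable_funD.
have gMM x : 0 <= g x + M <= M *+ 2.
  have := gM x; rewrite ler_norml mulr2n => /andP[? ?]; lra.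
apply/eqP; rewrite -normr_eq0 eq_le normr_ge0 andbT leNgt; apply/negP => m0.
set m := `|_| in m0.
(* This [n] gives [2 M H / m < n + 1 < 2 ^ (n + 1)], contradicting the bound [2 M H / 2 ^ (n + 1)]
   on [m]. *)
pose n := Num.trunc (M *+ 2 * H / m).
have := halving hH n.+1 mgM gMM; rewrite -/m.
rewrite ler_pdivlMr ?exprn_gt0// leNgt => /negP; apply.
rewrite -ltr_pdivrMl// mulrC (lt_trans (truncnS_gt _))// -/n.
by rewrite -natrX ltr_nat ltn_expl.
Qed.

End orthogonality.

(** * Conditional probabilities as functions of the conditioning value *)

Section cond_kernel.
Context d d1 (T : measurableType d) (T1 : measurableType d1) (R : realType).
Variable P : probability T R.
Implicit Types (E : set T) (X : {RV P >-> T1}) (f g : T1 -> R).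

(* [f] is the conditional probability of [E] as a function of the value of
   [X], i.e. [f x = P(E | X = x)]. *)
Definition cond_kernel E X f :=
  [/\ measurable_fun [set: T1] f, forall x, 0 <= f x <= 1 &
      forall B, measurable B ->
        mean P (fun w => \1_(X @^-1` B) w * f (X w)) =
        mean P (fun w => \1_(X @^-1` B) w * \1_E w)].

Lemma bmf_RV f X : bmf f -> bmf (fun w => f (X w)).
Proof. by move=> bf; apply: (bmf_comp bf); exact: measurable_funPT. Qed.

Lemma measurable_preimage_RV X (B : set T1) : measurable B -> measurable (X @^-1` B).
Proof.
by move=> mB; rewrite -[X in measurable X]setTI; apply: measurable_funPT.
Qed.

Lemma cond_kernel_bmf E X f : cond_kernel E X f -> bmf f.
Proof. by case=> mf f01 _; exact: bmf01. Qed.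

(** The difference of [f(X)] and the indicator of [E] is orthogonal to the events of [X], hence to
    every bounded function of [X]. *)
Lemma cond_kernel_mean E X f g : measurable E -> cond_kernel E X f -> bmf g ->
  mean P (fun w => g (X w) * f (X w)) = mean P (fun w => g (X w) * \1_E w).
Proof.
move=> mE kf bg; have bfX := bmf_RV X (cond_kernel_bmf kf).
have bE : bmf (\1_E : T -> R) by exact: bmf_indic.
have bgX := bmf_RV X bg.
apply/eqP; rewrite -subr_eq0 -meanB; [|exact: bmfM|exact: bmfM].
rewrite (@mean_eq _ _ _ _ _ (fun w => g (X w) * (f (X w) - \1_E w))); last first.
  by move=> w; rewrite mulrBr.
apply/eqP; apply: mean_orthogonal => //; first exact: bmfB.
move=> B mB; case: kf => mf f01 /(_ B mB).
have bB : bmf (\1_(X @^-1` B) : T -> R) by exact/bmf_indic/measurable_preimage_RV.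
move=> /eqP; rewrite -subr_eq0 -meanB; [|exact: bmfM|exact: bmfM].
by move=> /eqP <-; apply: mean_eq => w; rewrite mulrBr.
Qed.

Lemma cond_kernel_meanE E X f : measurable E -> cond_kernel E X f ->
  mean P (fun w => f (X w)) = fine (P E).
Proof.
move=> mE kf; have := cond_kernel_mean mE kf (bmf_cst _ 1).
under mean_eq do rewrite mul1r; move=> ->.
by rewrite -mean_indic//; apply: mean_eq => w; rewrite mul1r.
Qed.

(** The positive part of [u] has integral both nonnegative and at most zero, so it vanishes almost
    surely. This turns inequalities between integrals into almost sure ones. *)
Lemma integral_pos_le0_ae (u : T -> R) :
  P.-integrable [set: T] (EFin \o u) ->
  (\int[P]_(w in [set w | 0 < u w]%R) (u w)%:E <= 0)%E ->
  {ae P, forall w, u w <= 0}.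
Proof.
move=> iu; have mu : measurable_fun [set: T] u.
  exact/measurable_EFinP/(measurable_int _ iu).
pose v := fun w => Num.max (u w) 0; move=> u0.
have mv : measurable_fun [set: T] (EFin \o v).
  by apply/measurable_EFinP; exact: measurable_maxr.
have v0 : (\int[P]_w `|(EFin \o v) w| = 0)%E.
  apply/eqP; rewrite eq_le integral_ge0// andbT (le_trans _ u0)//.
  rewrite [leRHS]integral_mkcond le_eqVlt; apply/orP; left; apply/eqP.
  apply: eq_integral => w _; rewrite patchE /v/=.
  case: ifPn; rewrite ?inE ?notin_setE/=.
    by move=> uw; rewrite max_l ?ltW// ger0_norm ?ltW.
  by move=> /negP; rewrite -leNgt => uw; rewrite max_r// normr0.
have := (ae_eq_integral_abs P measurableT mv).1 v0.
apply: filterS => w /(_ I)[] /eqP; rewrite eq_le => /andP[+ _].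
by rewrite /v ge_max => /andP[].
Qed.

(** Almost sure uniqueness of versions, by showing that neither difference [s - f(X)] nor [f(X) - s]
    is positive with positive probability. *)
Lemma is_cond_prob_ae E X f s : measurable E ->
  cond_kernel E X f -> is_cond_prob E X s -> {ae P, forall w, s w = f (X w)}.
Proof.
move=> mE kf [ms si sE]; have bf := cond_kernel_bmf kf.
have fi := bmf_integrable P measurableT (bmf_RV X bf).
have mX : measurable_fun [set: g_sigma_algebra_preimageType X] (f \o X).
  move=> _ B mB; rewrite setTI; exists (f @^-1` B); last by rewrite setTI.
  by rewrite -[X in measurable X]setTI; exact: bf.1.
have key (u : T -> R) :
    u = (fun w => s w - f (X w)) \/ u = (fun w => f (X w) - s w) ->
    {ae P, forall w, u w <= 0}.
  move=> ucase.
  have mu : measurable_fun [set: g_sigma_algebra_preimageType X] u.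
    by case: ucase => ->; exact: measurable_funB.
  have iu : P.-integrable setT (EFin \o u).
    by case: ucase => ->; [exact: (integrableB measurableT si fi)|
                           exact: (integrableB measurableT fi si)].
  (* Since [u] is measurable for the sigma-algebra of [X], the set where it is positive is the
     preimage of some [B], and over it [s] and [f(X)] have the same integral. *)
  have [B mB] := mu measurableT _ (measurable_itv `]0, +oo[).
  rewrite !setTI => BE; apply: integral_pos_le0_ae => //.
  have -> : [set w | 0 < u w] = X @^-1` B.
    by rewrite BE; apply/seteqP; split => w /=; rewrite in_itv/= andbT.
  have mXB : measurable (X @^-1` B) by exact: measurable_preimage_RV.
  have sB := sE _ mB.
  have fB : (\int[P]_(w in X @^-1` B) (f (X w))%:E = P (E `&` X @^-1` B))%E.
    rewrite integral_preimage_mean//; last exact: bmf_RV.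
    have [_ _ ->//] := kf.
    rewrite -integral_preimage_mean//; last exact: bmf_indic.
    by rewrite integral_indic.
  have siB := integrableS measurableT mXB (@subsetT _ _) si.
  have fiB := integrableS measurableT mXB (@subsetT _ _) fi.
  have Pfin : P (E `&` X @^-1` B) \is a fin_num.
    by apply: fin_num_measure; exact: measurableI.
  case: ucase => ->; under eq_integral do rewrite EFinB.
    by rewrite integralB// sB fB subee.
  by rewrite integralB// sB fB subee.
have := key _ (or_introl erefl); apply: filterS2 (key _ (or_intror erefl)).
by move=> w; rewrite !subr_le0 => ? ?; apply/eqP; rewrite eq_le; apply/andP.
Qed.

Lemma cond_kernel_is_cond_prob E X f : measurable E ->
  cond_kernel E X f -> is_cond_prob E X (f \o X).
Proof.
move=> mE kf; have bf := cond_kernel_bmf kf; split.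
- move=> _ B mB; rewrite setTI; exists (f @^-1` B); last by rewrite setTI.
  by rewrite -[X in measurable X]setTI; exact: bf.1.
- exact: bmf_integrable (bmf_RV X bf).
- move=> B mB; have mXB : measurable (X @^-1` B) by exact: measurable_preimage_RV.
  rewrite integral_preimage_mean//; last exact: bmf_RV.
  have [_ _ ->//] := kf.
  rewrite -integral_preimage_mean//; last exact: bmf_indic.
  by rewrite integral_indic.
Qed.

End cond_kernel.

(** * Existence of conditional probabilities *)

Section cond_kernel_existence.
Context d d1 (T : measurableType d) (T1 : measurableType d1) (R : realType).
Variables (P : probability T R) (E : set T) (X : {RV P >-> T1}).
Hypothesis mE : measurable E.

Let nu (B : set T1) : \bar R := P (E `&` X @^-1` B).

Let nu0 : nu set0 = 0%E.
Proof. by rewrite /nu preimage_set0 setI0 measure0. Qed.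

Let nu_fin B : measurable B -> nu B \is a fin_num.
Proof.
move=> mB; apply: fin_num_measure; apply: measurableI => //.
exact: measurable_preimage_RV.
Qed.

Let nu_sigma : semi_sigma_additive nu.
Proof.
move=> F mF tF mUF; rewrite /nu preimage_bigcup setI_bigcupr.
apply: measure_semi_sigma_additive => //.
- by move=> n; apply: measurableI => //; exact: measurable_preimage_RV.
- by move=> i j _ _ [w [[_ Fi] [_ Fj]]]; apply: tF => //; exists (X w).
- apply: bigcup_measurable => k _; apply: measurableI => //.
  exact: measurable_preimage_RV.
Qed.

HB.instance Definition _ := isCharge.Build _ _ _ nu nu0 nu_fin nu_sigma.

(** The kernel is the Radon-Nikodym derivative of [nu] with respect to the law of [X], truncated to
    [0, 1]. *)
Lemma cond_kernel_exists : exists f, cond_kernel E X f.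
Proof.
pose f0 := Radon_Nikodym nu (distribution P X).
have nuX : nu `<< distribution P X.
  apply/null_content_dominatesP => A mA; rewrite /distribution/pushforward => A0.
  apply/eqP; rewrite eq_le measure_ge0 andbT -A0.
  rewrite le_measure ?inE//; last exact: measurable_preimage_RV.
  by apply: measurableI => //; exact: measurable_preimage_RV.
have f0fin x : f0 x \is a fin_num by exact: Radon_Nikodym_fin_num.
have f0i : (distribution P X).-integrable setT f0 by exact: Radon_Nikodym_integrable.
have mf0 : measurable_fun setT f0 by exact: measurable_int f0i.
pose f1 x := fine (f0 x).
have mf1 : measurable_fun setT f1 by exact: measurableT_comp.
have Ef1 : EFin \o f1 = f0 by apply/funext => x /=; rewrite fineK.
have f1i : (distribution P X).-integrable setT (EFin \o f1) by rewrite Ef1.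
have mB_ (B : set T1) : measurable B -> (distribution P X).-integrable B (EFin \o f1).
  by move=> mB; exact: integrableS f1i.
have f1E B : measurable B -> (\int[distribution P X]_(x in B) (f1 x)%:E = nu B)%E.
  by move=> mB; rewrite (Radon_Nikodym_integral nuX mB) -/f0 -Ef1.
(* Over the set where the density is negative its integral is a value of [nu], hence nonnegative.
   The upper bound 1 follows likewise from [nu] being below the law of [X]. *)
have f1_ge0 : {ae distribution P X, forall x, - f1 x <= 0}.
  apply: integral_pos_le0_ae.
    by rewrite (_ : _ \o _ = \- (EFin \o f1))%E//; exact: integrableN.
  have mB : measurable [set x | 0 < - f1 x].
    rewrite (_ : mkset _ = f1 @^-1` `]-oo, 0[).
      by rewrite -[X in measurable X]setTI; exact: mf1.
    by apply/seteqP; split => x /=; rewrite in_itv/= oppr_gt0.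
  rewrite (_ : \int[_]_(w in _) _ = - (nu [set x | 0 < - f1 x]%R))%E.
    by rewrite leeNl oppe0 measure_ge0.
  by rewrite -f1E// -integralN//; exact: integrable_add_def (mB_ _ mB).
have f1_le1 : {ae distribution P X, forall x, f1 x - 1 <= 0}.
  have i1 := finite_measure_integrable_cst (distribution P X) 1 (@measurableT _ T1).
  apply: integral_pos_le0_ae; first exact: (integrableB measurableT f1i i1).
  have mB : measurable [set x | 0 < f1 x - 1].
    rewrite (_ : mkset _ = f1 @^-1` `]1, +oo[).
      by rewrite -[X in measurable X]setTI; exact: mf1.
    by apply/seteqP; split => x /=; rewrite in_itv/= subr_gt0 andbT.
  under eq_integral do rewrite EFinB.
  rewrite integralB//; [|exact: mB_|exact: integrableS i1].
  rewrite f1E// integral_cst// mul1e leeBlDr ?add0e.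
    rewrite le_measure ?inE//; last exact: measurable_preimage_RV.
    by apply: measurableI => //; exact: measurable_preimage_RV.
  by rewrite fin_num_measure//; exact: measurable_preimage_RV.
(* The density lies in [0, 1] only almost surely; the truncation makes the bounds hold at every
   point. *)
pose f x := Num.min 1 (Num.max 0 (f1 x)).
have mf : measurable_fun setT f.
  by apply: measurable_minr => //; exact: measurable_maxr.
have f01 x : 0 <= f x <= 1.
  by rewrite /f ge_min lexx/= le_min ler01 le_max lexx.
have ff1 : {ae distribution P X, forall x, f x = f1 x}.
  apply: filterS2 f1_ge0 f1_le1 => x; rewrite oppr_le0 subr_le0 => ? ?.
  by rewrite /f max_r// min_r.
exists f; split => // B mB.
have bB : bmf (\1_B : T1 -> R) by exact: bmf_indic.
have bf : bmf f by exact: bmf01.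
have bh : bmf (fun x => \1_B x * f x) by exact: bmfM.
have mXB : measurable (X @^-1` B) by exact: measurable_preimage_RV.
suff fE : (\int[P]_(w in X @^-1` B) (f (X w))%:E = nu B)%E.
  apply: EFin_inj; rewrite -!integral_preimage_mean//; last 2 first.
  - exact: bmf_indic.
  - exact: bmf_RV.
  by rewrite fE integral_indic.
rewrite -f1E//.
have <- : (\int[distribution P X]_(x in B) (f x)%:E =
           \int[P]_(w in X @^-1` B) (f (X w))%:E)%E.
  apply: integral_pushforward => //; first exact/measurable_EFinP.
  exact: bmf_integrable (bmf_RV X bf).
apply: ae_eq_integral => //.
- exact/measurable_funTS/measurable_EFinP.
- exact/measurable_funTS/measurable_EFinP.
- by apply: filterS ff1 => x /= ->.
Qed.

End cond_kernel_existence.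

(** * Subgradients and Jensen's inequality *)

Section convex_functions.
Context (R : realType).
Implicit Types (phi : R -> R).

Lemma convex_functionE phi : convex_function [set: R^o] phi <->
  forall l x y, 0 <= l <= 1 ->
    phi (l * x + (1 - l) * y) <= l * phi x + (1 - l) * phi y.
Proof.
split=> [cphi l x y /andP[l0 l1]|cphi l x y _ _].
  have := cphi (Itv01 l0 l1) x y (mem_setT _) (mem_setT _).
  by rewrite !convRE.
by rewrite !convRE; apply: cphi; rewrite ge0 le1.
Qed.

Lemma convex_sqr : convex_function [set: R^o] (fun x : R => x ^+ 2).
Proof.
apply/convex_functionE => l x y /andP[l0 l1]; rewrite -subr_ge0.
rewrite (_ : _ - _ = l * (1 - l) * (x - y) ^+ 2); last by ring.
by apply: mulr_ge0; rewrite ?sqr_ge0// mulr_ge0 ?subr_ge0.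
Qed.

(** Convexity at the weight [(t - s) / (t - u)], multiplied out so that slopes can be compared by
    linear arithmetic. *)
Lemma convex_chord phi : convex_function [set: R^o] phi -> forall u s t, u < s -> s < t ->
  (t - u) * phi s <= (t - s) * phi u + (s - u) * phi t.
Proof.
move=> /convex_functionE cphi u s t us st.
have tu0 : 0 < t - u by rewrite subr_gt0 (lt_trans us).
have l01 : 0 <= (t - s) / (t - u) <= 1.
  by apply/andP; split; [apply: divr_ge0; lra|rewrite ler_pdivrMr//; lra].
have := cphi _ u t l01; rewrite -(ler_pM2l tu0).
have -> : (t - s) / (t - u) * u + (1 - (t - s) / (t - u)) * t = s.
  by field; rewrite gt_eqF.
move=> /le_trans; apply; rewrite le_eqVlt; apply/orP; left; apply/eqP.
by field; rewrite gt_eqF.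
Qed.

(** The right derivative works: as the infimum [g s] of the slopes to the right of [s], it is at
    least every slope to the left. *)
Lemma convex_subgradient phi : convex_function [set: R^o] phi ->
  exists2 g : R -> R, {homo g : x y / x <= y} &
    forall s t, phi s + g s * (t - s) <= phi t.
Proof.
move=> cphi; pose sl s t := (phi t - phi s) / (t - s).
have sl3 u s t : u < s -> s < t -> sl u s <= sl s t.
  move=> us st; rewrite /sl ler_pdivrMr ?subr_gt0// mulrAC.
  rewrite ler_pdivlMr ?subr_gt0//.
  by have := convex_chord cphi us st; lra.
pose g s := inf [set sl s t | t in [set t | s < t]].
have g_lb u s : u < s -> sl u s <= g s.
  move=> us; apply: lb_le_inf; first by exists (sl s (s + 1)), (s + 1); rewrite //= ltrDl.
  by move=> _ [t /= st <-]; exact: sl3.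
have g_ub s t : s < t -> g s <= sl s t.
  move=> st; apply: ge_inf; last by exists t.
  by exists (sl (s - 1) s) => _ [x /= sx <-]; apply: sl3 => //; rewrite gtrDl ltrN10.
exists g.
  move=> x y; rewrite le_eqVlt => /predU1P[->//|xy].
  exact: le_trans (g_ub _ _ xy) (g_lb _ _ xy).
move=> s t; have [st|ts|->] := ltgtP s t.
- by have := g_ub _ _ st; rewrite /sl ler_pdivlMr ?subr_gt0//; lra.
- by have := g_lb _ _ ts; rewrite /sl ler_pdivrMr ?subr_gt0//; lra.
- by rewrite subrr mulr0 addr0.
Qed.

(** Strict sublevel sets of a convex function are intervals, hence Borel. *)
Lemma convex_measurable phi : convex_function [set: R^o] phi ->
  measurable_fun [set: R] phi.
Proof.
move=> /convex_functionE cphi.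
apply: (measurability _ (RGenInftyO.measurableE R)) => _ /= -[_ [c ->] <-].
rewrite setTI; apply: is_interval_measurable => x y /=.
rewrite !in_itv/= => xc yc z /andP[xz zy].
have [xy|xy] := eqVneq x y.
  by have -> : z = x by apply/eqP; rewrite eq_le xz andbT xy.
have xy' : 0 < y - x by rewrite subr_gt0 lt_neqAle xy (le_trans xz).
have l01 : 0 <= (y - z) / (y - x) <= 1.
  by apply/andP; split; [apply: divr_ge0; lra|rewrite ler_pdivrMr//; lra].
have := cphi _ x y l01.
have -> : (y - z) / (y - x) * x + (1 - (y - z) / (y - x)) * y = z.
  by field; rewrite gt_eqF.
move=> /le_lt_trans; apply; move: l01; set l := _ / _ => /andP[l0 l1].
pose M := Num.max (phi x) (phi y); apply: (@le_lt_trans _ _ M).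
  rewrite [leRHS](_ : M = l * M + (1 - l) * M); last by ring.
  by apply: lerD; rewrite ler_wpM2l ?subr_ge0// le_max lexx ?orbT.
by rewrite /M gt_max xc.
Qed.

(** On [0, 1] the function lies below its chord between the endpoints and above its supporting line
    at 0. *)
Lemma bmf_convex d (T : measurableType d) phi (s : T -> R) :
  convex_function [set: R^o] phi -> measurable_fun [set: T] s ->
  (forall w, 0 <= s w <= 1) -> bmf (fun w => phi (s w)).
Proof.
move=> cphi ms s01; split; first exact: (measurableT_comp (convex_measurable cphi)).
have [g _ gP] := convex_subgradient cphi.
exists (`|phi 0| + `|phi 1| + `|g 0|) => w; have /andP[s0 s1] := s01 w.
have h := (convex_functionE phi).1 cphi (s w) 1 0 (s01 w).
rewrite mulr1 mulr0 addr0 in h.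
have h' := gP 0 (s w); rewrite subr0 in h'.
have sphi1 : s w * phi 1 <= `|phi 1|.
  by rewrite (le_trans (ler_norm _))// normrM (ger0_norm s0) ler_piMl.
have sphi0 : (1 - s w) * phi 0 <= `|phi 0|.
  rewrite (le_trans (ler_norm _))// normrM ger0_norm ?subr_ge0// ler_piMl//.
  by rewrite lerBlDr lerDl.
have gs : - `|g 0| <= g 0 * s w.
  rewrite lerNl (le_trans (ler_norm _))// normrN normrM (ger0_norm s0).
  by rewrite ler_piMr.
have := ler_norm (- phi 0); rewrite normrN => phi0.
have := normr_ge0 (phi 0); have := normr_ge0 (phi 1); have := normr_ge0 (g 0).
rewrite ler_norml => ? ? ?; apply/andP; split; lra.
Qed.

(** Integrate the subgradient inequality at [s] and evaluate it at [t]; the last hypothesis, which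
    says that [s] is the conditional expectation of [t] given [s], kills the linear term. *)
Lemma mean_convex_le d (T : measurableType d) (P : probability T R) phi (s t : T -> R) :
  convex_function [set: R^o] phi ->
  measurable_fun [set: T] s -> (forall w, 0 <= s w <= 1) ->
  measurable_fun [set: T] t -> (forall w, 0 <= t w <= 1) ->
  (forall g : R -> R, bmf g -> mean P (fun w => g (s w) * (t w - s w)) = 0) ->
  mean P (fun w => phi (s w)) <= mean P (fun w => phi (t w)).
Proof.
move=> cphi ms s01 mt t01 st; have [g gh gP] := convex_subgradient cphi.
(* Clamping the argument to [0, 1] makes the monotone [g] bounded without changing it at the values
   of [s]. *)
pose g1 x := g (Num.min 1 (Num.max 0 x)).
have bg1 : bmf g1.
  split.
    apply: nondecreasing_measurable => // x y xy; apply: gh.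
    by rewrite le_min ge_min lexx/= ge_min ge_max !le_max lexx xy !orbT.
  exists (`|g 0| + `|g 1|) => x; rewrite /g1.
  set y := Num.min _ _.
  have /andP[y0 y1] : 0 <= y <= 1.
    by rewrite /y ge_min lexx/= le_min ler01 le_max lexx.
  have := gh _ _ y0; have := gh _ _ y1.
  have := ler_norm (- g 0); have := ler_norm (g 1); rewrite normrN.
  have := normr_ge0 (g 0); have := normr_ge0 (g 1).
  by rewrite ler_norml => *; apply/andP; split; lra.
have bs := bmf01 ms s01; have bt := bmf01 mt t01.
have bg1s : bmf (fun w => g1 (s w)) by exact: (bmf_comp bg1).
have bphis := bmf_convex cphi ms s01.
rewrite -[leLHS]addr0 -(st g1 bg1) -meanD//; last first.
  by apply: bmfM => //; exact: bmfB.
apply: le_mean => //.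
- by apply: bmfD => //; apply: bmfM => //; exact: bmfB.
- exact: bmf_convex.
- move=> w; rewrite /g1; have /andP[s0 s1] := s01 w.
  by rewrite max_r// min_r.
Qed.

End convex_functions.

(** * Quantile events and distribution functions *)

Section quantile.
Context d (T : measurableType d) (R : realType) (P : probability T R).
Implicit Types (Y W : {RV P >-> R}) (v y : R).

Lemma cdfR_nondecreasing Y : {homo cdfR Y : x y / x <= y}.
Proof. by move=> x y xy; rewrite /cdfR fine_le ?fin_num_measure// cdf_nondecreasing. Qed.

Lemma cdfR_lt_ex Y v : 0 < v -> exists y, cdfR Y y < v.
Proof.
move=> v0; have /fine_cvg/cvgr_lt/(_ v v0) h := cvg_cdfNy0 Y.
by have [y ?] := filter_ex h; exists y.
Qed.

Lemma cdfR_gt_ex Y v : v < 1 -> exists y, v < cdfR Y y.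
Proof.
move=> v1; have /fine_cvg/cvgr_gt/(_ v v1) h := cvg_cdfy1 Y.
by have [y ?] := filter_ex h; exists y.
Qed.

Lemma cdfR_ge_right Y v y : (forall z, y < z -> v <= cdfR Y z) -> v <= cdfR Y y.
Proof.
move=> vF; rewrite leNgt; apply/negP => Fv.
have := @cdf_right_continuous _ _ _ _ Y y.
rewrite -(@fineK _ (cdf Y y)) ?fin_num_measure// => /fine_cvg/cvgr_lt/(_ v Fv) h.
have [z [Fz yz]] : exists z, (fine \o cdf Y) z < v /\ y < z.
  exact: (@filter_ex _ _ (at_right_proper_filter y) _ (filterI h (nbhs_right_gt y))).
by move: Fz; rewrite ltNge => /negP; apply; exact: vF.
Qed.

Lemma cdfR01 Y y : 0 <= cdfR Y y <= 1.
Proof.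
rewrite /cdfR fine_ge0//= -[leRHS]/(fine (1%E : \bar R)).
by rewrite fine_le ?fin_num_measure// cdf_le1.
Qed.

(** The Galois connection between quantile and distribution function: for [v] in (0, 1) the set is
    nonempty and bounded below, and right continuity makes its infimum a member. *)
Lemma quantile_le Y v y : 0 < v < 1 -> (quantile Y v <= y) = (v <= cdfR Y y).
Proof.
move=> /andP[v0 v1].
have hi : has_inf [set y | v <= cdfR Y y].
  split; first by have [z /ltW zv] := cdfR_gt_ex Y v1; exists z.
  have [z zv] := cdfR_lt_ex Y v0; exists z => x /= vx.
  rewrite leNgt; apply/negP => /ltW /(cdfR_nondecreasing Y).
  by move=> /(le_trans vx); rewrite leNgt zv.
apply/idP/idP => [qy|vy]; last by apply: ge_inf => //; case: hi.
apply: cdfR_ge_right => z yz.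
have zq : 0 < z - quantile Y v by rewrite subr_gt0 (le_lt_trans qy).
have [x /= vx] := inf_adherent zq hi.
rewrite -/(quantile Y v) addrC subrK => xz.
by rewrite (le_trans vx)//; exact/cdfR_nondecreasing/ltW.
Qed.

Lemma quantile_event Y v : 0 < v < 1 ->
  [set w | quantile Y v <= Y w] = [set w | v <= cdfR Y (Y w)].
Proof. by move=> v01; apply/seteqP; split => w /=; rewrite quantile_le. Qed.

Lemma measurable_quantile_event Y v : measurable [set w | quantile Y v <= Y w].
Proof.
rewrite (_ : mkset _ = Y @^-1` `[quantile Y v, +oo[).
  exact: measurable_preimage_RV.
by apply/seteqP; split => w /=; rewrite in_itv/= andbT.
Qed.

(** The quantile event depends on [Y] only through [cdfR Y (Y w)]. It serves for strictly increasing
    [g] and for [g] equal to the distribution function itself. *)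
Lemma cdfR_comp_quantile_event (g : R -> R) (mg : measurable_fun setT g) Y v :
  (forall y, cdfR (comp_RV mg Y) (g y) = cdfR Y y) -> 0 < v < 1 ->
  [set w | quantile (comp_RV mg Y) v <= comp_RV mg Y w] =
  [set w | quantile Y v <= Y w].
Proof.
by move=> gF v01; rewrite !quantile_event//; apply/seteqP; split => w /=; rewrite gF.
Qed.

Lemma quantile_event_sub Y v y : 0 < v < 1 -> cdfR Y y < v ->
  [set w | quantile Y v <= Y w] `<=` [set w | y < Y w].
Proof.
move=> v01 Fv w /=; apply: lt_le_trans.
by rewrite ltNge quantile_le// -ltNge.
Qed.

Lemma measurable_gt_event Y y : measurable [set w | y < Y w].
Proof.
rewrite (_ : mkset _ = Y @^-1` `]y, +oo[); first exact: measurable_preimage_RV.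
by apply/seteqP; split => w /=; rewrite in_itv/= andbT.
Qed.

Lemma prob_gt Y y : P [set w | y < Y w] = (1 - cdfR Y y)%:E.
Proof.
have -> : [set w | y < Y w] = ~` (Y @^-1` `]-oo, y]).
  by apply/seteqP; split => w /=; rewrite in_itv/= ltNge => /negP.
rewrite probability_setC; last exact: measurable_preimage_RV.
by rewrite EFinB /cdfR fineK// fin_num_measure.
Qed.

(** The complement [Y < q] is the increasing union of the events [Y <= q - 1/(n+1)], at whose
    endpoints the distribution function is below [v], hence at most [c]. *)
Lemma prob_quantile_event_ge Y v c : 0 < v < 1 ->
  (forall y, cdfR Y y < v -> cdfR Y y <= c) ->
  ((1 - c)%:E <= P [set w | quantile Y v <= Y w]%R)%E.
Proof.
move=> v01 Fc; set q := quantile Y v.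
pose F n := Y @^-1` `]-oo, q - n.+1%:R^-1].
have mF n : measurable (F n) by exact: measurable_preimage_RV.
have ndF : {homo F : m n / (m <= n)%N >-> (m <= n)%O}.
  move=> m n mn; apply/subsetPset => w; rewrite /F/= !in_itv/= => /le_trans; apply.
  by rewrite lerB// lef_pV2 ?posrE// ler_nat.
have UF : \bigcup_n F n = ~` [set w | q <= Y w].
  apply/seteqP; split => [w [n _]|w /negP] /=.
    rewrite /F/= in_itv/= => Yq; apply/negP; rewrite -ltNge (le_lt_trans Yq)//.
    by rewrite ltrBlDr ltrDl.
  rewrite -ltNge -subr_gt0 => /ltr_add_invr[n nq]; exists n => //=.
  by rewrite /F/= in_itv/=; move: nq; rewrite add0r ltrBrDr lerBrDr addrC => /ltW.
have mU : measurable (\bigcup_n F n) by exact: bigcup_measurable.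
have /(_ mU ndF) := @nondecreasing_cvg_mu _ _ _ P F mF.
rewrite UF => PF; have mq := measurable_quantile_event Y v.
rewrite -[X in P X]setCK probability_setC; last exact: measurableC.
have : (P (~` [set w | (q <= Y w)%R]) <= c%:E)%E.
  rewrite -(cvg_lim _ PF)//; apply: lime_le.
    by apply/cvg_ex; eexists; exact: PF.
  apply: nearW => n /=.
  rewrite -[P (F n)]fineK ?fin_num_measure// lee_fin Fc//.
  rewrite ltNge -quantile_le// -/q -ltNge.
  by rewrite ltrBlDr ltrDl.
rewrite -[P (~` _)]fineK ?fin_num_measure//; last exact: measurableC.
by rewrite lee_fin -EFinB lee_fin => ?; rewrite lerB.
Qed.

(** The ray has mass [1 - cdfR Y y], and the quantile event inside it has mass at least [1 - v]. *)
Lemma quantile_event_approx Y v y : 0 < v < 1 -> cdfR Y y < v ->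
  (P ([set w | y < Y w]%R `\` [set w | quantile Y v <= Y w]%R) <=
   (v - cdfR Y y)%:E)%E.
Proof.
move=> v01 Fv; have sub := quantile_event_sub v01 Fv.
have mq := measurable_quantile_event Y v.
have my := measurable_gt_event Y y.
rewrite measureD//; last by rewrite ltey_eq fin_num_measure.
rewrite setIidr// [X in (X - _)%E](prob_gt Y y).
have := prob_quantile_event_ge v01 (fun y => @ltW _ _ (cdfR Y y) v).
rewrite -[P [set w | quantile Y v <= Y w]%R]fineK ?fin_num_measure//.
rewrite lee_fin => vq.
rewrite -[X in (_ - X)%E]fineK ?fin_num_measure// -EFinB lee_fin.
rewrite [leRHS](_ : _ = (1 - cdfR Y y) - (1 - v)); last by ring.
exact: lerB.
Qed.

(* The ray [Y > y] is approximated in measure by the events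
   [Y >= quantile Y v], with [v] decreasing to [cdfR Y y]. *)
Lemma quantile_events_determine Y (h : T -> R) : bmf h -> mean P h = 0 ->
  (forall v, 0 < v < 1 ->
    mean P (fun w => \1_[set w | quantile Y v <= Y w] w * h w) = 0) ->
  forall B, measurable B -> mean P (fun w => \1_(Y @^-1` B) w * h w) = 0.
Proof.
move=> bh h0 qh; apply: (@mean_preimage_dynkin _ _ _ _ _ _ _ _ _ _ (@RGenOInfty.G R)) => //.
- exact: RGenOInfty.measurableE.
- move=> _ _ [x ->] [y ->]; exists (Num.max x y).
  by apply/seteqP; split => z; rewrite /= !in_itv/= !andbT gt_max => /andP.
move=> _ [y ->].
have -> : Y @^-1` `]y, +oo[ = [set w | y < Y w].
  by apply/seteqP; split => w /=; rewrite in_itv/= andbT.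
have my := measurable_gt_event Y y.
have [H hH] := bh.2.
have H0 : 0 <= H by rewrite (le_trans _ (hH point)).
have key v : 0 < v < 1 -> cdfR Y y < v ->
    `|mean P (fun w => \1_[set w | y < Y w] w * h w)| <= H * (v - cdfR Y y).
  move=> v01 Fv; have sub := quantile_event_sub v01 Fv.
  have mq := measurable_quantile_event Y v.
  have bq := bmf_indic R mq; have by_ := bmf_indic R my.
  rewrite -[X in `|X|]subr0 -(qh _ v01) -meanB; [|exact: bmfM|exact: bmfM].
  have bD := bmf_indic R (measurableD my mq).
  rewrite (@mean_eq _ _ _ _ _
    (fun w => \1_([set w | y < Y w] `\` [set w | quantile Y v <= Y w]) w * h w)).
    rewrite (le_trans (le_norm_mean _ (bmfM bD bh)))//.
    apply: (@le_trans _ _ (mean P (fun w => H *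
      \1_([set w | y < Y w] `\` [set w | quantile Y v <= Y w]) w))).
      apply: le_mean.
      - exact/bmf_norm/bmfM.
      - by apply: bmfM => //; exact: bmf_cst.
      - move=> w; rewrite normrM ger0_norm ?indic_ge0// mulrC.
        by apply: ler_wpM2r => //; exact: indic_ge0.
    rewrite meanZ// mean_indic; last exact: measurableD.
    rewrite ler_wpM2l// -lee_fin fineK ?fin_num_measure//; last exact: measurableD.
    exact: quantile_event_approx.
  move=> w; rewrite -mulrBl; congr (_ * _).
  rewrite !indicE in_setD.
  have [/set_mem wq|] := boolP (w \in [set w | quantile Y v <= Y w]).
    by rewrite (mem_set (sub _ wq)) subrr.
  by rewrite subr0 andbT.
have /andP[F0 F1] := cdfR01 Y y.
have bhy : bmf (fun w => \1_[set w | y < Y w] w * h w).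
  by apply: bmfM => //; exact: bmf_indic.
apply/eqP; rewrite -normr_eq0 eq_le normr_ge0 andbT.
(* If [cdfR Y y = 1], no level [v < 1] lies above it, but then the ray itself is null. *)
have [F1E|F1E] := eqVneq (cdfR Y y) 1.
  rewrite (le_trans (le_norm_mean _ bhy))//.
  apply: (@le_trans _ _ (mean P (fun w => H * \1_[set w | y < Y w] w))).
    apply: le_mean.
    - exact: bmf_norm.
    - by apply: bmfM; [exact: bmf_cst|exact: bmf_indic].
    - move=> w; rewrite normrM ger0_norm ?indic_ge0// mulrC.
      by apply: ler_wpM2r => //; exact: indic_ge0.
  rewrite meanZ ?mean_indic//; last exact: bmf_indic.
  by rewrite prob_gt F1E subrr mulr0.
have {F1E}F1 : cdfR Y y < 1 by rewrite lt_neqAle F1E.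
apply/ler_addgt0Pr => e e0; rewrite add0r.
(* The midpoint keeps [v] below 1; the other term makes the error at most [e], with [H + 1] in place
   of [H] as a positive denominator. *)
pose v := Num.min ((1 + cdfR Y y) / 2) (cdfR Y y + e / (H + 1)).
have eH : 0 < e / (H + 1) by rewrite divr_gt0// ltr_wpDl.
have Fv : cdfR Y y < v.
  by rewrite /v lt_min ltrDl eH andbT; lra.
have v01 : 0 < v < 1.
  rewrite (le_lt_trans F0 Fv)/= /v gt_min; apply/orP; left; lra.
rewrite (le_trans (key _ v01 Fv))//.
rewrite (@le_trans _ _ ((H + 1) * (e / (H + 1))))//.
  apply: ler_pM => //; first by rewrite subr_ge0 ltW.
    by rewrite lerDl.
  by rewrite lerBlDl /v ge_min lexx orbT.
by rewrite mulrC divfK// gt_eqF// ltr_wpDl.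
Qed.

(* A flat piece of the distribution function carries no mass. *)
Lemma ae_cdfR_gt Y y : {ae P, forall w, y < Y w <-> cdfR Y y < cdfR Y (Y w)}.
Proof.
have my := measurable_gt_event Y y.
have mF : measurable [set w | cdfR Y y < cdfR Y (Y w)].
  rewrite (_ : mkset _ = Y @^-1` (cdfR Y @^-1` `]cdfR Y y, +oo[)).
    apply: measurable_preimage_RV; rewrite -[X in measurable X]setTI.
    exact: measurable_cdfR.
  by apply/seteqP; split => w /=; rewrite in_itv/= andbT.
exists ([set w | y < Y w] `\` [set w | cdfR Y y < cdfR Y (Y w)]); split.
- exact: measurableD.
- apply/eqP; rewrite eq_le measure_ge0 andbT.
  have [F1E|F1E] := eqVneq (cdfR Y y) 1.
    apply: (@le_trans _ _ (P [set w | y < Y w])).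
      by apply: le_measure; rewrite ?inE; [exact: measurableD|exact: my|exact: subDsetl].
    by rewrite prob_gt F1E subrr.
  have /andP[F0 F1] := cdfR01 Y y.
  have {F1E F1}F1 : 0 < 1 - cdfR Y y by rewrite subr_gt0 lt_neqAle F1E.
  apply/lee_addgt0Pr => e e0; rewrite add0e.
  (* The exceptional set lies in the difference of the ray and the quantile event at level
     [cdfR Y y + r], so its mass is at most [r]; half the gap to 1 keeps this level below 1. *)
  pose r := Num.min e ((1 - cdfR Y y) / 2).
  have r0 : 0 < r by rewrite /r lt_min e0 divr_gt0.
  have v01 : 0 < cdfR Y y + r < 1.
    rewrite ltr_wpDl//= -ltrBrDl /r gt_min; apply/orP; right.
    by rewrite ltr_pdivrMr// ltr_pMr// ltr1n.
  have Fv : cdfR Y y < cdfR Y y + r by rewrite ltrDl.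
  apply: (@le_trans _ _ (cdfR Y y + r - cdfR Y y)%:E); last first.
    by rewrite lee_fin addrAC subrr add0r /r ge_min lexx.
  apply: le_trans (quantile_event_approx v01 Fv).
  apply: le_measure; rewrite ?inE.
  + exact: measurableD.
  + by apply: measurableD => //; exact: measurable_quantile_event.
  + move=> w [yw nF]; split => //= qw; apply: nF => /=.
    by move: qw; rewrite quantile_le//; exact: lt_le_trans.
- move=> w /= nE; apply: contrapT => h; apply: nE; split=> [yw|Fyw].
    by apply: contrapT => Fyw; apply: h.
  rewrite ltNge; apply/negP => /(cdfR_nondecreasing Y); rewrite leNgt => /negP.
  exact.
Qed.

(** The probability of [Y < quantile Y v] is the supremum of the values of the distribution function
    below [v], which can be approximated from the closure of its range. *)
Lemma prob_quantile_event_le Y Y' v : 0 < v < 1 ->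
  closure (range (cdfR Y)) `<=` closure (range (cdfR Y')) ->
  (P [set w | quantile Y' v <= Y' w]%R <= P [set w | quantile Y v <= Y w]%R)%E.
Proof.
move=> v01 YY'; have mq := measurable_quantile_event Y' v.
set p' := P [set w | quantile Y' v <= Y' w].
have p'fin : p' \is a fin_num by rewrite fin_num_measure.
rewrite -(@fineK _ p')// -[fine p'](subKr 1); apply: prob_quantile_event_ge => // y Fv.
rewrite lerBrDr addrC -lerBrDr; apply/ler_addgt0Pr => e e0.
(* A value of [cdfR Y'] closer to [cdfR Y y] than [v - cdfR Y y] is still below [v]. *)
pose e' := Num.min e (v - cdfR Y y).
have e'0 : 0 < e' by rewrite /e' lt_min e0 subr_gt0.
have [_ [[y' _ <-] yy']] : range (cdfR Y') `&` ball (cdfR Y y) e' !=set0.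
  have cY : closure (range (cdfR Y)) (cdfR Y y).
    by apply: subset_closure; exists y.
  exact: (YY' _ cY _ (nbhsx_ballx _ _ e'0)).
have {yy'} : `|cdfR Y y - cdfR Y' y'| < e' by [].
rewrite /e' lt_min !ltr_norml => /andP[/andP[_ h1] /andP[h2 _]].
have F'v : cdfR Y' y' < v by lra.
have : (p' <= (1 - cdfR Y' y')%:E)%E.
  rewrite -prob_gt le_measure ?inE//; last exact: quantile_event_sub.
  exact: measurable_gt_event.
by rewrite -(@fineK _ p')// lee_fin; lra.
Qed.

Lemma prob_quantile_event_eq Y Y' v : 0 < v < 1 ->
  closure (range (cdfR Y)) = closure (range (cdfR Y')) ->
  P [set w | quantile Y v <= Y w] = P [set w | quantile Y' v <= Y' w].
Proof.
move=> v01 YY'; apply/eqP; rewrite eq_le.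
by rewrite !prob_quantile_event_le// YY'.
Qed.

End quantile.

(** * The conditional convex order in terms of kernels *)

Section conditional_convex_order.
Context d (T : measurableType d) (R : realType) (P : probability T R).

Lemma expectation_convex_version d1 (T1 : measurableType d1) (X : {RV P >-> T1})
    E (f : T1 -> R) (s : T -> R) (phi : R -> R) :
  convex_function [set: R^o] phi -> measurable E -> cond_kernel E X f ->
  is_cond_prob E X s ->
  ('E_P[phi \o s] = (mean P (fun w => phi (f (X w))))%:E)%E.
Proof.
move=> cphi mE kf sv; have [mf f01 _] := kf.
have bphi : bmf (fun x => phi (f x)) by exact: bmf_convex.
have mphi := convex_measurable cphi.
have ms : measurable_fun setT s.
  by case: sv => _ /(measurable_int _) /measurable_EFinP.
have mfX : measurable_fun setT (fun w => phi (f (X w))) := (bmf_RV X bphi).1.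
rewrite unlock meanE; last exact: (bmf_RV X bphi).
apply: ae_eq_integral => //.
- apply/measurable_EFinP; exact: (measurableT_comp mphi ms).
- by apply/measurable_EFinP.
- by apply: filterS (is_cond_prob_ae mE kf sv) => w /= ->.
Qed.

(** One pair of kernels for each [v] is enough, because every version agrees with its kernel almost
    surely. *)
Lemma ccx_kernels p (Y : {RV P >-> R}) (X : {RV P >-> p.-tuple R})
    p' (Y' : {RV P >-> R}) (X' : {RV P >-> p'.-tuple R}) :
  (forall v, 0 < v < 1 -> exists f f',
    [/\ cond_kernel [set w | quantile Y v <= Y w] X f,
        cond_kernel [set w | quantile Y' v <= Y' w] X' f' &
        forall phi, convex_function [set: R^o] phi ->
          mean P (fun w => phi (f (X w))) <= mean P (fun w => phi (f' (X' w)))]) ->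
  ccx Y X Y' X'.
Proof.
move=> H v v01 s s' vs vs' phi cphi; have [f [f' [kf kf' le]]] := H v v01.
rewrite (expectation_convex_version cphi _ kf vs)//; last exact: measurable_quantile_event.
rewrite (expectation_convex_version cphi _ kf' vs')//; last exact: measurable_quantile_event.
by rewrite lee_fin; exact: le.
Qed.

Lemma ccx_kernels_le p (Y : {RV P >-> R}) (X : {RV P >-> p.-tuple R})
    p' (Y' : {RV P >-> R}) (X' : {RV P >-> p'.-tuple R}) v f f' phi :
  ccx Y X Y' X' -> 0 < v < 1 ->
  cond_kernel [set w | quantile Y v <= Y w] X f ->
  cond_kernel [set w | quantile Y' v <= Y' w] X' f' ->
  convex_function [set: R^o] phi ->
  mean P (fun w => phi (f (X w))) <= mean P (fun w => phi (f' (X' w))).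
Proof.
move=> YX v01 kf kf' cphi.
have mE := measurable_quantile_event Y v; have mE' := measurable_quantile_event Y' v.
have vf := cond_kernel_is_cond_prob mE kf.
have vf' := cond_kernel_is_cond_prob mE' kf'.
have := YX _ v01 _ _ vf vf' _ cphi.
rewrite (expectation_convex_version cphi mE kf vf).
by rewrite (expectation_convex_version cphi mE' kf' vf') lee_fin.
Qed.

Lemma ccx_trans p1 p2 p3 (Y1 Y2 Y3 : {RV P >-> R}) (X1 : {RV P >-> p1.-tuple R})
    (X2 : {RV P >-> p2.-tuple R}) (X3 : {RV P >-> p3.-tuple R}) :
  ccx Y1 X1 Y2 X2 -> ccx Y2 X2 Y3 X3 -> ccx Y1 X1 Y3 X3.
Proof.
move=> h12 h23 v v01 s s' vs vs' phi cphi.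
(* The order quantifies over versions, so chaining the two inequalities requires an actual version
   for the middle vector. *)
have [f kf] := cond_kernel_exists X2 (measurable_quantile_event Y2 v).
have vf := cond_kernel_is_cond_prob (measurable_quantile_event Y2 v) kf.
exact: le_trans (h12 _ v01 _ _ vs vf _ cphi) (h23 _ v01 _ _ vf vs' _ cphi).
Qed.

(* This is the conditional Jensen inequality. *)
Lemma ccx_factor p q (Y Y' : {RV P >-> R}) (X : {RV P >-> p.-tuple R})
    (W : {RV P >-> q.-tuple R}) (k : q.-tuple R -> p.-tuple R) :
  (forall v, 0 < v < 1 ->
    [set w | quantile Y v <= Y w] = [set w | quantile Y' v <= Y' w]) ->
  measurable_fun [set: q.-tuple R] k -> {ae P, forall w, X w = k (W w)} ->
  ccx Y X Y' W.
Proof.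
move=> YY' mk XkW; apply: ccx_kernels => v v01; rewrite -YY'//.
set E := mkset _; have mE : measurable E := measurable_quantile_event Y v.
have [f kf] := cond_kernel_exists X mE; have [t kt] := cond_kernel_exists W mE.
exists f, t; split => // phi cphi.
have [mf f01 _] := kf; have [mt t01 _] := kt.
have bf := cond_kernel_bmf kf; have bt := cond_kernel_bmf kt.
have bfX := bmf_RV X bf; have btW := bmf_RV W bt.
have bE := bmf_indic R mE.
apply: mean_convex_le => //.
- exact: bfX.1.
- exact: btW.1.
move=> g bg; have bgf : bmf (fun x => g (f x)) by exact: bmf_comp bg mf.
have bgfX := bmf_RV X bgf.
have bgfk : bmf (fun x => g (f (k x))) by exact: bmf_comp bgf mk.
have bgfkW := bmf_RV W bgfk.
(* Both products have the mean of [g(f(X))] over the event [E], since [g(f(X))] is a function of [X]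
   and almost surely one of [W]. *)
rewrite (@mean_eq _ _ _ _ _ (fun w => g (f (X w)) * t (W w) - g (f (X w)) * f (X w))).
  rewrite meanB; [|exact: bmfM|exact: bmfM].
  rewrite (cond_kernel_mean mE kf bgf).
  rewrite (@ae_mean_eq _ _ _ P _ (fun w => g (f (k (W w))) * t (W w))).
  - rewrite (cond_kernel_mean mE kt bgfk); apply/eqP; rewrite subr_eq0; apply/eqP.
    apply: ae_mean_eq; [exact: bmfM|exact: bmfM|].
    by apply: filterS XkW => w ->.
  - exact: bmfM.
  - exact: bmfM.
  - by apply: filterS XkW => w ->.
by move=> w; rewrite mulrBr.
Qed.

Lemma ccx_cat p q (Y : {RV P >-> R}) (X : {RV P >-> p.-tuple R})
  (Z : {RV P >-> q.-tuple R}) : ccx Y X Y (cat_RV X Z).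
Proof.
apply: (@ccx_factor _ _ _ _ _ _ (fun x => [tuple tnth x (lshift q i) | i < p])) => //.
  apply/measurable_fun_tnthP => i.
  rewrite (_ : _ \o _ = (@tnth (p + q) R)^~ (lshift q i)); first exact: measurable_tnth.
  by apply/funext => x /=; rewrite tnth_mktuple.
by apply: aeW => w; apply: eq_from_tnth => i; rewrite tnth_mktuple/= tnth_lshift.
Qed.

Lemma ccx_refl p (Y : {RV P >-> R}) (X : {RV P >-> p.-tuple R}) : ccx Y X Y X.
Proof. by apply: (@ccx_factor _ _ _ _ _ _ id) => //; exact: aeW. Qed.

Lemma distribution_mean d1 (T1 : measurableType d1) (X X' : {RV P >-> T1}) (g : T1 -> R) :
  (forall B, measurable B -> P (X @^-1` B) = P (X' @^-1` B)) -> bmf g ->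
  mean P (fun w => g (X w)) = mean P (fun w => g (X' w)).
Proof.
move=> XX' bg; apply: EFin_inj; rewrite !meanE; [|exact: (bmf_RV X' bg)|exact: (bmf_RV X bg)].
have mg : measurable_fun setT (EFin \o g) by exact/measurable_EFinP/bg.1.
rewrite -[LHS]/(\int[P]_w ((EFin \o g) \o X) w)%E.
rewrite -[RHS]/(\int[P]_w ((EFin \o g) \o X') w)%E.
rewrite -!integral_distribution//; last 2 first.
- exact: bmf_integrable (bmf_RV X' bg).
- exact: bmf_integrable (bmf_RV X bg).
by apply: eq_measure_integral => B mB _; exact: XX'.
Qed.

(** A kernel is a function on the value space and its defining identity involves only the joint law,
    so one [f] serves both vectors. *)
Lemma eq_dist_ccx p (Y Y' : {RV P >-> R}) (X X' : {RV P >-> p.-tuple R}) :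
  eq_dist Y X Y' X' -> ccx Y X Y' X'.
Proof.
move=> YX.
have XX' B : measurable B -> P (X @^-1` B) = P (X' @^-1` B).
  move=> mB; have := YX _ (measurableX (@measurableT _ R) mB).
  rewrite [X in P X = _ -> _](_ : _ = X @^-1` B); last by apply/seteqP; split => w //= [].
  by rewrite [X in _ = P X -> _](_ : _ = X' @^-1` B)//; apply/seteqP; split => w //= [].
have FF' : cdfR Y = cdfR Y'.
  apply/funext => y; rewrite /cdfR; congr fine.
  have := YX _ (measurableX (measurable_itv `]-oo, y]) (@measurableT _ (p.-tuple R))).
  rewrite [X in P X = _ -> _](_ : _ = Y @^-1` `]-oo, y]); last by apply/seteqP; split => w //= [].
  by rewrite [X in _ = P X -> _](_ : _ = Y' @^-1` `]-oo, y])//; apply/seteqP; split => w //= [].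
apply: ccx_kernels => v v01.
have qq' : quantile Y v = quantile Y' v by rewrite /quantile FF'.
have [f kf] := cond_kernel_exists X (measurable_quantile_event Y v).
have bf := cond_kernel_bmf kf.
have [mf f01 fE] := kf.
exists f, f; split => //; last first.
  move=> phi cphi; rewrite (@distribution_mean _ _ X X' (fun x => phi (f x)))//.
  exact: bmf_convex.
split => // B mB.
rewrite -(@distribution_mean _ _ X X' (fun x => \1_B x * f x))//; last first.
  by apply: bmfM => //; exact: bmf_indic.
rewrite [LHS]fE//.
rewrite !mean_indicM//; try exact: measurable_quantile_event; try exact: measurable_preimage_RV.
have := YX _ (measurableX (measurable_itv `[quantile Y v, +oo[) mB).
rewrite [X in P X = _ -> _](_ : _ = X @^-1` B `&` [set w | quantile Y v <= Y w]); last first.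
  by apply/seteqP; split => w /= []; rewrite in_itv/= andbT.
rewrite [X in _ = P X -> _](_ : _ = X' @^-1` B `&` [set w | quantile Y' v <= Y' w]).
  by move=> ->.
by apply/seteqP; split => w /= []; rewrite in_itv/= andbT -qq'.
Qed.

End conditional_convex_order.

(** * Real numbers from their rational cuts *)

Section countable_sup.
Context (R : realType).

Definition ratseq (n : nat) : R := ratr (odflt 0 (unpickle n : option rat)).

Lemma ratseq_dense (x y : R) : x < y -> exists2 n, x < ratseq n & ratseq n < y.
Proof.
move=> /rat_in_itvoo[q]; rewrite in_itv/= => /andP[xq qy].
by exists (pickle q); rewrite /ratseq pickleK.
Qed.

(** Decodes a Dedekind cut given as a bit sequence. The supremum is taken in the extended reals, so
    that it is defined for all sequences; [fine] sends infinite values to 0. *)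
Definition cut_sup (c : nat -> bool) : R :=
  fine (esups (fun n => if c n then (ratseq n)%:E else -oo%E) 0).

Lemma cut_supE (y : R) : cut_sup (fun n => ratseq n < y) = y.
Proof.
rewrite /cut_sup /esups/= /sdrop (_ : ereal_sup _ = y%:E)//.
apply/eqP; rewrite eq_le; apply/andP; split.
  apply: ge_ereal_sup => _ [n _ <-].
  by case: ifPn => [/ltW|_]; rewrite ?lee_fin ?leNye.
apply/lee_subgt0Pr => e e0.
have [n yn ny] : exists2 n, y - e < ratseq n & ratseq n < y.
  by apply: ratseq_dense; rewrite ltrBlDr ltrDl.
apply: le_ereal_sup_tmp; exists (ratseq n)%:E.
  by exists n => //=; rewrite ny.
by rewrite -EFinB lee_fin ltW.
Qed.

Lemma measurable_cut_sup d (T : measurableType d) (c : T -> nat -> bool) :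
  (forall n, measurable [set x | c x n]) ->
  measurable_fun [set: T] (fun x => cut_sup (c x)).
Proof.
move=> mc; apply: measurableT_comp => //.
apply: (@measurable_fun_esups _ _ _ _
  (fun n x => if c x n then (ratseq n)%:E else -oo%E)) => n.
apply: measurable_fun_ifT => //.
apply: (measurable_fun_bool true).
by rewrite setTI; exact: mc.
Qed.

End countable_sup.

(** * Factorization through a random variable up to null sets *)

Section factorization.
Context d d1 (T : measurableType d) (T1 : measurableType d1) (R : realType).
Variables (P : probability T R) (V : T -> T1).

(** The value of [Y] is decoded from the events [Y > q], [q] rational; there are countably many, so
    their exceptional null sets can be united. *)
Lemma ae_factor (Y : T -> R) :
  (forall y, exists2 C : set T1, measurable C &
     {ae P, forall w, y < Y w <-> C (V w)}) ->
  exists2 f : T1 -> R, measurable_fun [set: T1] f & {ae P, forall w, Y w = f (V w)}.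
Proof.
move=> YC; have /choice[C CP] n : exists C : set T1,
    measurable C /\ {ae P, forall w, ratseq R n < Y w <-> C (V w)}.
  by have [C] := YC (ratseq R n); exists C.
exists (fun x => cut_sup R (fun n => x \in C n)).
  apply: (@measurable_cut_sup _ _ _ (fun x n => x \in C n)) => n.
  rewrite (_ : [set _ | _] = C n); first by have [] := CP n.
  by apply/seteqP; split => x /=; rewrite inE.
have := ae_foralln (fun n => (CP n).2); apply: filterS => w CY.
rewrite -[LHS](cut_supE (Y w)); congr cut_sup; apply/funext => n.
by apply/idP/idP => [/CY/mem_set//|/set_mem/CY].
Qed.

Lemma ae_factor_tuple p (X : T -> p.-tuple R) :
  (forall i y, exists2 C : set T1, measurable C &
     {ae P, forall w, y < tnth (X w) i <-> C (V w)}) ->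
  exists2 k : T1 -> p.-tuple R,
    measurable_fun [set: T1] k & {ae P, forall w, X w = k (V w)}.
Proof.
move=> XC; have /choice[k kP] i : exists f : T1 -> R,
    measurable_fun [set: T1] f /\ {ae P, forall w, tnth (X w) i = f (V w)}.
  by have [f] := ae_factor (XC i); exists f.
exists (fun x => [tuple k i x | i < p]).
  apply/measurable_fun_tnthP => i.
  rewrite (_ : _ \o _ = k i); first by have [] := kP i.
  by apply/funext => x /=; rewrite tnth_mktuple.
have : {ae P, forall w, forall i, tnth (X w) i = k i (V w)}.
  (* The finite family of coordinates is padded to a sequence so that the countable union of null
     sets applies. *)
  have : {ae P, forall w, forall n, if insub n is Some i then
                             tnth (X w) i = k i (V w) else True}.
    apply: ae_foralln => n; case: insubP => [i _ _|_]; last exact: aeW.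
    by have [] := kP i.
  by apply: filterS => w h i; have := h i; rewrite valK.
by apply: filterS => w h; apply: eq_from_tnth => i; rewrite tnth_mktuple h.
Qed.

End factorization.

(** * Minimal and maximal elements of the order *)

Section extremal_elements.
Context d (T : measurableType d) (R : realType) (P : probability T R).

(** Pythagoras: orthogonality of [s] and [t - s] makes the second moment of [t - s] the difference
    of those of [t] and [s]. *)
Lemma mean_sqr_le_ae (s t : T -> R) : bmf s -> bmf t ->
  mean P (fun w => s w * (t w - s w)) = 0 ->
  mean P (fun w => t w ^+ 2) <= mean P (fun w => s w ^+ 2) ->
  {ae P, forall w, t w = s w}.
Proof.
move=> bs bt st0 ts; have bts := bmfB bt bs.
have bst := bmfM bs bts.
have bt2 : bmf (fun w => t w ^+ 2) := bmfM bt bt.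
have bs2 : bmf (fun w => s w ^+ 2) := bmfM bs bs.
have bts2 : bmf (fun w => (t w - s w) ^+ 2) := bmfM bts bts.
have /(mean_eq0_ae bts2) : mean P (fun w => (t w - s w) ^+ 2) = 0.
  apply/eqP; rewrite eq_le mean_ge0 ?andbT; last by move=> w; exact: sqr_ge0.
  rewrite (@mean_eq _ _ _ _ _
    (fun w => (t w ^+ 2 - s w ^+ 2) - 2 * (s w * (t w - s w)))).
    rewrite meanB; [|exact: bmfB|by apply: bmfM => //; exact: bmf_cst].
    by rewrite meanB// meanZ// st0 mulr0 subr0 subr_le0.
  by move=> w; ring.
move=> /(_ (fun w => sqr_ge0 _)); apply: filterS => w /eqP.
by rewrite sqrf_eq0 subr_eq0 => /eqP.
Qed.

(** The test vector for minimality: it is independent of everything, so its kernels are constant. *)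
Definition cst_tuple_RV p (x : p.-tuple R) : {RV P >-> p.-tuple R} :=
  HB.pack (fun _ : T => x) (isMeasurableFun.Build _ _ _ _ (fun _ : T => x)
    (measurable_cst x)).

Lemma measurable_tuple1 (Y : {RV P >-> R}) :
  measurable_fun [set: T] (fun w => [tuple Y w]).
Proof.
apply/measurable_fun_tnthP => i; rewrite (_ : _ \o _ = Y).
  exact: measurable_funPT.
by apply/funext => w /=; rewrite (tnth_nth 0) (ord1 i).
Qed.

(** The test vector for maximality: conditioning on [Y] itself turns kernels into indicators. *)
Definition tuple1_RV (Y : {RV P >-> R}) : {RV P >-> 1.-tuple R} :=
  HB.pack (fun w => [tuple Y w])
    (isMeasurableFun.Build _ _ _ _ (fun w => [tuple Y w]) (measurable_tuple1 Y)).

Lemma cond_kernel_independent d1 (T1 : measurableType d1) (X : {RV P >-> T1}) E :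
  measurable E ->
  (forall B, measurable B -> (P (X @^-1` B `&` E) = P (X @^-1` B) * P E)%E) ->
  cond_kernel E X (fun=> fine (P E)).
Proof.
move=> mE XE; split => //.
  move=> _; rewrite fine_ge0//= -[leRHS]/(fine (1%E : \bar R)).
  by rewrite fine_le ?fin_num_measure// probability_le1.
move=> B mB; have mXB := measurable_preimage_RV X mB.
rewrite mean_indicM// XE// fineM ?fin_num_measure// -(mean_indic P mXB).
rewrite mulrC -meanZ; last exact: bmf_indic.
by apply: mean_eq => w; rewrite mulrC.
Qed.

(** Under independence the kernel is the constant [P E], which is also the mean of the other kernel
    because the closed ranges agree; Jensen's inequality compares them. *)
Lemma ccx_minimal (A : set R) p (Y : {RV P >-> R}) (X : {RV P >-> p.-tuple R})
    p' (Y' : {RV P >-> R}) (X' : {RV P >-> p'.-tuple R}) :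
  in_RA A Y X -> in_RA A Y' X' -> independent X Y -> ccx Y X Y' X'.
Proof.
move=> [_ YA] [_ YA'] XY; apply: ccx_kernels => v v01.
have mE := measurable_quantile_event Y v.
have mE' := measurable_quantile_event Y' v.
have PE : P [set w | quantile Y v <= Y w] = P [set w | quantile Y' v <= Y' w].
  by apply: prob_quantile_event_eq; rewrite // YA YA'.
have [f kf] := cond_kernel_exists X' mE'.
have bf := cond_kernel_bmf kf; have bfX := bmf_RV X' bf.
have [mf f01 _] := kf.
have YE : [set w | quantile Y v <= Y w] = Y @^-1` `[quantile Y v, +oo[.
  by apply/seteqP; split => w /=; rewrite in_itv/= andbT.
have kc : cond_kernel [set w | quantile Y v <= Y w] X
    (fun=> fine (P [set w | quantile Y v <= Y w])).
  by apply: cond_kernel_independent => // B mB; rewrite YE XY.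
have [_ c01 _] := kc.
exists (fun=> fine (P [set w | quantile Y v <= Y w])), f; split => // phi cphi.
apply: mean_convex_le => //; first by move=> w; exact: c01 (X w).
  exact: bfX.1.
move=> g bg; rewrite meanZ; last by apply: bmfB => //; exact: bmf_cst.
by rewrite meanB ?mean_cst ?(cond_kernel_meanE mE' kf) ?PE ?subrr ?mulr0//; exact: bmf_cst.
Qed.

(** Comparison with a constant vector bounds the second moment of the kernel by the square of its
    mean, so the kernel is almost surely constant. Thus [X] is independent of all quantile events,
    and these determine the events of [Y]. *)
Lemma minimal_independent (A : set R) p (Y : {RV P >-> R}) (X : {RV P >-> p.-tuple R}) :
  in_RA A Y X ->
  (forall p' (Y' : {RV P >-> R}) (X' : {RV P >-> p'.-tuple R}),
     in_RA A Y' X' -> ccx Y X Y' X') -> independent X Y.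
Proof.
move=> [_ YA] min B C mB mC.
pose X' := cst_tuple_RV [tuple (0 : R)].
have {min} YX := min 1%N Y X' (conj erefl YA).
have mXB := measurable_preimage_RV X mB; have mYC := measurable_preimage_RV Y mC.
pose c := fine (P (X @^-1` B)).
have bB := bmf_indic R mXB.
(* Independence is restated as orthogonality of the centred indicator of [X] in [B] to the events of
   [Y]. *)
suff : mean P (fun w => \1_(Y @^-1` C) w * (\1_(X @^-1` B) w - c)) = 0.
  rewrite (@mean_eq _ _ _ _ _
    (fun w => \1_(X @^-1` B) w * \1_(Y @^-1` C) w - c * \1_(Y @^-1` C) w)).
    have bC := bmf_indic R mYC.
    rewrite meanB; [|exact: bmfM|by apply: bmfM => //; exact: bmf_cst].
    rewrite meanZ// mean_indicM// mean_indic// => /eqP.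
    rewrite subr_eq0 -fineM ?fin_num_measure// => /eqP h.
    rewrite -[LHS]fineK ?fin_num_measure//; last exact: measurableI.
    by rewrite h fineK// fin_numM ?fin_num_measure.
  by move=> w; ring.
apply: quantile_events_determine mC; first by apply: bmfB => //; exact: bmf_cst.
  by rewrite meanB ?mean_cst ?mean_indic ?subrr//; exact: bmf_cst.
move=> v v01; set E := mkset _.
have mE : measurable E := measurable_quantile_event Y v.
have bE := bmf_indic R mE.
have [f kf] := cond_kernel_exists X mE; have bf := cond_kernel_bmf kf.
have bfX := bmf_RV X bf.
have kc : cond_kernel E X' (fun=> fine (P E)).
  apply: cond_kernel_independent => // D mD.
  have [D0|D0] := pselect (D [tuple 0]).
    rewrite (_ : X' @^-1` D = setT) ?setTI ?probability_setT ?mul1e//.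
    by apply/seteqP; split.
  rewrite (_ : X' @^-1` D = set0) ?set0I ?measure0 ?mul0e//.
  by apply/seteqP; split.
have fE : {ae P, forall w, f (X w) = fine (P E)}.
  apply: mean_sqr_le_ae => //; first exact: bmf_cst.
    rewrite meanZ; last by apply: bmfB => //; exact: bmf_cst.
    by rewrite meanB ?mean_cst ?(cond_kernel_meanE mE kf) ?subrr ?mulr0//; exact: bmf_cst.
  exact: (ccx_kernels_le YX v01 kf kc (@convex_sqr R)).
have [_ _ /(_ B mB)] := kf.
rewrite (@ae_mean_eq _ _ _ _ _ (fun w => fine (P E) * \1_(X @^-1` B) w)).
- rewrite meanZ// mean_indic// -/c => cE.
  rewrite (@mean_eq _ _ _ _ _ (fun w => \1_(X @^-1` B) w * \1_E w - c * \1_E w)).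
    rewrite meanB; [|exact: bmfM|by apply: bmfM => //; exact: bmf_cst].
    by rewrite meanZ// -cE mean_indic// mulrC subrr.
  by move=> w; ring.
- exact: bmfM.
- by apply: bmfM => //; exact: bmf_cst.
- by apply: filterS fE => w ->; rewrite mulrC.
Qed.

(** Perfect dependence makes the kernel an indicator, on which [phi] equals its chord over [0, 1];
    for any other kernel of the same mean [phi] lies below that chord. *)
Lemma ccx_maximal (A : set R) p (Y : {RV P >-> R}) (X : {RV P >-> p.-tuple R})
    p' (Y' : {RV P >-> R}) (X' : {RV P >-> p'.-tuple R}) :
  in_RA A Y X -> in_RA A Y' X' -> perfectly_dependent Y X -> ccx Y' X' Y X.
Proof.
move=> [_ YA] [_ YA'] [F mF YF]; apply: ccx_kernels => v v01.
have mE := measurable_quantile_event Y v.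
have mE' := measurable_quantile_event Y' v.
have PE : P [set w | quantile Y v <= Y w] = P [set w | quantile Y' v <= Y' w].
  by apply: prob_quantile_event_eq; rewrite // YA YA'.
have [f kf] := cond_kernel_exists X' mE'.
have bf := cond_kernel_bmf kf; have bfX := bmf_RV X' bf.
have [mf f01 _] := kf.
pose D := F @^-1` `[quantile Y v, +oo[.
have mD : measurable D by rewrite -[D]setTI; exact: mF.
have bD := bmf_indic R mD; have bDX := bmf_RV X bD.
have DE : {ae P, forall w, \1_D (X w) = \1_[set w | quantile Y v <= Y w] w :> R}.
  apply: filterS YF => w Yw; rewrite !indicE; congr (_%:R); congr nat_of_bool.
  by apply/idP/idP => /set_mem h; apply/mem_set; move: h; rewrite /D /= in_itv/= andbT Yw.
have bE := bmf_indic R mE.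
exists f, \1_D; split => //.
  split; [exact: bD.1|by move=> x; rewrite indic_ge0 indic_le1|].
  move=> B mB; have bB := bmf_indic R (measurable_preimage_RV X mB).
  by apply: ae_mean_eq; [exact: bmfM|exact: bmfM|apply: filterS DE => w ->].
move=> phi cphi.
have bphiD : bmf (fun w => phi (\1_D (X w))).
  by apply: bmf_convex => //; [exact: bDX.1|move=> w; rewrite indic_ge0 indic_le1].
have bphif : bmf (fun w => phi (f (X' w))) by apply: bmf_convex => //; exact: bfX.1.
rewrite [leRHS](@mean_eq _ _ _ _ _ (fun w => (phi 1 - phi 0) * \1_D (X w) + phi 0)).
  rewrite meanD; [|by apply: bmfM => //; exact: bmf_cst|exact: bmf_cst].
  rewrite meanZ// mean_cst (ae_mean_eq bDX bE DE) mean_indic// PE.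
  rewrite -(cond_kernel_meanE mE' kf) -meanZ// -[X in _ + X](mean_cst P) -meanD//; last 2 first.
  - by apply: bmfM => //; exact: bmf_cst.
  - exact: bmf_cst.
  apply: le_mean => //.
    by apply: bmfD; [apply: bmfM => //; exact: bmf_cst|exact: bmf_cst].
  move=> w; have := (convex_functionE phi).1 cphi _ 1 0 (f01 (X' w)).
  by rewrite mulr1 mulr0 addr0; lra.
by move=> w; rewrite indicE; case: (_ \in _) => /=; ring.
Qed.

(** Comparison with [Y] itself forces the kernel to have the second moment of an indicator, hence to
    be that indicator. Every quantile event is then an event of [X], and so is every ray of [Y]. *)
Lemma maximal_perfectly_dependent (A : set R) p (Y : {RV P >-> R})
    (X : {RV P >-> p.-tuple R}) : in_RA A Y X ->
  (forall p' (Y' : {RV P >-> R}) (X' : {RV P >-> p'.-tuple R}),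
     in_RA A Y' X' -> ccx Y' X' Y X) -> perfectly_dependent Y X.
Proof.
move=> [_ YA] max; pose X' := tuple1_RV Y.
have {max} YX := max 1%N Y X' (conj erefl YA).
have qX v : 0 < v < 1 -> exists2 D : set (p.-tuple R), measurable D &
    {ae P, forall w, quantile Y v <= Y w <-> D (X w)}.
  move=> v01; have mE := measurable_quantile_event Y v.
  have [f kf] := cond_kernel_exists X mE; have bf := cond_kernel_bmf kf.
  have bfX := bmf_RV X bf; have bE := bmf_indic R mE.
  pose g (x : 1.-tuple R) : R := \1_(`[quantile Y v, +oo[) (tnth x ord0).
  have gE w : g (X' w) = \1_[set w | quantile Y v <= Y w] w.
    rewrite /g !indicE; congr (_%:R); congr nat_of_bool.
    by apply/idP/idP => /set_mem h; apply/mem_set; move: h; rewrite /= in_itv/= andbT.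
  have kg : cond_kernel [set w | quantile Y v <= Y w] X' g.
    split.
    - by apply: measurableT_comp; [exact: measurable_indic|exact: measurable_tnth].
    - by move=> x; rewrite indic_ge0 indic_le1.
    - by move=> B mB; apply: mean_eq => w; rewrite gE.
  have fE : {ae P, forall w, \1_[set w | quantile Y v <= Y w] w = f (X w)}.
    apply: mean_sqr_le_ae => //.
      rewrite (@mean_eq _ _ _ _ _ (fun w => f (X w) * \1_[set w | quantile Y v <= Y w] w
        - f (X w) * f (X w))); last by move=> w; ring.
      rewrite meanB; [|exact: bmfM|exact: bmfM].
      by rewrite (cond_kernel_mean mE kf bf) subrr.
    have := ccx_kernels_le YX v01 kg kf (@convex_sqr R).
    by under mean_eq do rewrite gE.
  exists (f @^-1` [set 1]); first by rewrite -[X in measurable X]setTI; exact: bf.1.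
  apply: filterS fE => w fw; rewrite /= -fw indicE.
  split=> [Yw|]; first by rewrite mem_set.
  by case: (boolP (w \in _)) => [/set_mem//|_ /eqP]; rewrite eq_sym oner_eq0.
apply: ae_factor => y; have /andP[F0 _] := cdfR01 Y y.
(* Up to a null set, [y < Y] means that some rational level lies strictly above [cdfR Y y] and at
   most at [cdfR Y (Y w)]. Levels outside ([cdfR Y y], 1) receive the empty set. *)
have /choice[D DP] n : exists D : set (p.-tuple R), measurable D /\
    {ae P, forall w, (cdfR Y y < ratseq R n <= cdfR Y (Y w) /\ ratseq R n < 1) <-> D (X w)}.
  have [/andP[yn n1]|yn] := boolP (cdfR Y y < ratseq R n < 1); last first.
    exists set0; split => //; apply: aeW => w; split => // -[/andP[yn' _] n1].
    by rewrite yn' n1 in yn.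
  have n01 : 0 < ratseq R n < 1 by rewrite n1 (le_lt_trans F0).
  have [D mD DE] := qX _ n01; exists D; split => //.
  by apply: filterS DE => w <-; rewrite quantile_le// yn; split=> [[]|].
exists (\bigcup_n D n); first by apply: bigcup_measurable => n _; case: (DP n).
apply: filterS2 (ae_foralln (fun n => (DP n).2)) (ae_cdfR_gt Y y) => w Dw ->.
split=> [yw|[n _ /Dw[/andP[yn nw] _]]]; last exact: lt_le_trans nw.
have [n yn nw] := ratseq_dense yw; exists n => //; apply/Dw.
by rewrite yn ltW// (lt_le_trans nw)//; have /andP[] := cdfR01 Y (Y w).
Qed.

End extremal_elements.

(** * Equality in the order and conditional independence *)

Section conditional_independence.
Context d (T : measurableType d) (R : realType) (P : probability T R).
Variables (p q : nat) (Y : {RV P >-> R}) (X : {RV P >-> p.-tuple R})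
  (Z : {RV P >-> q.-tuple R}).

Let W := cat_RV X Z.

Let fst_tuple (x : (p + q).-tuple R) : p.-tuple R := [tuple tnth x (lshift q i) | i < p].
Let snd_tuple (x : (p + q).-tuple R) : q.-tuple R := [tuple tnth x (rshift p i) | i < q].

Let measurable_fst_tuple : measurable_fun [set: (p + q).-tuple R] fst_tuple.
Proof.
apply/measurable_fun_tnthP => i.
rewrite (_ : _ \o _ = (@tnth (p + q) R)^~ (lshift q i)); first exact: measurable_tnth.
by apply/funext => x /=; rewrite tnth_mktuple.
Qed.

Let measurable_snd_tuple : measurable_fun [set: (p + q).-tuple R] snd_tuple.
Proof.
apply/measurable_fun_tnthP => i.
rewrite (_ : _ \o _ = (@tnth (p + q) R)^~ (rshift p i)); first exact: measurable_tnth.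
by apply/funext => x /=; rewrite tnth_mktuple.
Qed.

Let fst_tupleE w : fst_tuple (W w) = X w.
Proof. by apply: eq_from_tnth => i; rewrite tnth_mktuple/= tnth_lshift. Qed.

Let snd_tupleE w : snd_tuple (W w) = Z w.
Proof. by apply: eq_from_tnth => i; rewrite tnth_mktuple/= tnth_rshift. Qed.

Let measurable_cat : measurable_fun [set: p.-tuple R * q.-tuple R]
  (fun x => [tuple of x.1 ++ x.2] : (p + q).-tuple R).
Proof.
apply/measurable_fun_tnthP => i; case: (split_ordP i) => j ->.
  rewrite (_ : _ \o _ = (@tnth p R)^~ j \o fst).
    by apply: measurableT_comp; [exact: measurable_tnth|exact: measurable_fst].
  by apply/funext => x /=; rewrite tnth_lshift.
rewrite (_ : _ \o _ = (@tnth q R)^~ j \o snd).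
  by apply: measurableT_comp; [exact: measurable_tnth|exact: measurable_snd].
by apply/funext => x /=; rewrite tnth_rshift.
Qed.

(** Comparing second moments shows that conditioning quantile events on [Z] in addition to [X]
    changes nothing; the product formula follows for them and extends to all events of [Y]. *)
Lemma eq_ccx_cond_independent : eq_ccx Y X Y W -> cond_independent Y Z X.
Proof.
move=> [XW WX] B C mB mC s t u sv tv uv.
have mYB := measurable_preimage_RV Y mB; have mZC := measurable_preimage_RV Z mC.
have mBC := measurableI _ _ mYB mZC.
have [f kf] := cond_kernel_exists X mYB; have [g kg] := cond_kernel_exists X mZC.
have bf := cond_kernel_bmf kf; have bg := cond_kernel_bmf kg.
have bfX := bmf_RV X bf; have bgX := bmf_RV X bg.
have bB := bmf_indic R mYB; have bC := bmf_indic R mZC.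
suff kfg : cond_kernel (Y @^-1` B `&` Z @^-1` C) X (fun x => f x * g x).
  apply: filterS3 (is_cond_prob_ae mYB kf sv) (is_cond_prob_ae mZC kg tv)
    (is_cond_prob_ae mBC kfg uv) => w -> -> ->.
  by [].
split; first exact: (bmfM bf bg).1.
  move=> x; have [_ + _] := kf; move=> /(_ x)/andP[f0 f1].
  have [_ + _] := kg; move=> /(_ x)/andP[g0 g1].
  by rewrite mulr_ge0//= -[leRHS]mulr1 ler_pM.
move=> D mD; have bD := bmf_indic R mD.
have bDX := bmf_RV X bD.
(* The product formula over [X] in [D] says exactly that this function integrates to zero over the
   event [Y] in [B]. *)
pose h w := \1_D (X w) * (g (X w) - \1_(Z @^-1` C) w).
have bh : bmf h by apply: bmfM => //; exact: bmfB.
have bDg : bmf (fun x => \1_D x * g x) by exact: bmfM.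
suff : mean P (fun w => \1_(Y @^-1` B) w * h w) = 0.
  rewrite (@mean_eq _ _ _ _ _ (fun w =>
    (\1_D (X w) * g (X w)) * \1_(Y @^-1` B) w -
    \1_(X @^-1` D) w * \1_(Y @^-1` B `&` Z @^-1` C) w)).
    rewrite meanB; last 2 first.
    - by apply: bmfM => //; exact: (bmf_RV X bDg).
    - by apply: bmfM => //; exact: bmf_indic.
    rewrite -(cond_kernel_mean mYB kf bDg) => /eqP; rewrite subr_eq0 => /eqP <-.
    by apply: mean_eq => w; rewrite mulrAC !mulrA.
  by move=> w; rewrite /h indicI/=; rewrite -[\1_D (X w)]/(\1_(X @^-1` D) w : R); ring.
apply: quantile_events_determine mB => //.
  rewrite /h (@mean_eq _ _ _ _ _ (fun w => \1_D (X w) * g (X w) - \1_D (X w) * \1_(Z @^-1` C) w)).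
    by rewrite meanB; [rewrite (cond_kernel_mean mZC kg bD) subrr|exact: bmfM|exact: bmfM].
  by move=> w; rewrite mulrBr.
move=> v v01; set E := mkset _.
have mE : measurable E := measurable_quantile_event Y v.
have bE := bmf_indic R mE.
have [f' kf'] := cond_kernel_exists X mE; have [t' kt'] := cond_kernel_exists W mE.
have bf' := cond_kernel_bmf kf'; have bt' := cond_kernel_bmf kt'.
have bf'X := bmf_RV X bf'; have bt'W := bmf_RV W bt'.
have bf'W : bmf (fun x => f' (fst_tuple x)) by exact: bmf_comp bf' measurable_fst_tuple.
(* The kernel given [X] is the projection of the kernel given [W], so the inequality of second
   moments forces equality. *)
have tf : {ae P, forall w, t' (W w) = f' (X w)}.
  apply: mean_sqr_le_ae => //; last first.
    exact: (ccx_kernels_le WX v01 kt' kf' (@convex_sqr R)).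
  have := cond_kernel_mean mE kt' bf'W.
  under mean_eq do rewrite fst_tupleE.
  under [RHS]mean_eq do rewrite fst_tupleE.
  rewrite -(cond_kernel_mean mE kf' bf') => /eqP; rewrite -subr_eq0.
  rewrite -meanB; [|exact: bmfM|exact: bmfM]; move=> /eqP <-.
  by apply: mean_eq => w; rewrite mulrBr.
pose DC x : R := \1_D (fst_tuple x) * \1_C (snd_tuple x).
have bDC : bmf DC.
  apply: bmfM; first exact: bmf_comp bD measurable_fst_tuple.
  exact: bmf_comp (bmf_indic R mC) measurable_snd_tuple.
have bDf' : bmf (fun x => \1_D x * f' x) by exact: bmfM.
have bDf'X := bmf_RV X bDf'; have bDgX := bmf_RV X bDg; have bDCW := bmf_RV W bDC.
(* Replacing the indicator of [E] by [f'(X)] in the first term and by [t'(W) = f'(X)] in the second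
   leaves the two sides of the kernel identity for the event [Z] in [C]. *)
rewrite (@mean_eq _ _ _ _ _ (fun w =>
    (\1_D (X w) * g (X w)) * \1_E w - DC (W w) * \1_E w)).
  rewrite meanB; [|exact: bmfM|exact: bmfM].
  rewrite -(cond_kernel_mean mE kf' bDg) -(cond_kernel_mean mE kt' bDC).
  rewrite (@ae_mean_eq _ _ _ P (fun w => DC (W w) * t' (W w))
    (fun w => (\1_D (X w) * f' (X w)) * \1_(Z @^-1` C) w)).
  - rewrite -(cond_kernel_mean mZC kg bDf'); apply/eqP; rewrite subr_eq0; apply/eqP.
    by apply: mean_eq => w; rewrite mulrAC.
  - exact: bmfM.
  - exact: bmfM.
  - apply: filterS tf => w ->; rewrite /DC fst_tupleE snd_tupleE.
    by rewrite mulrAC.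
move=> w; rewrite /h /DC fst_tupleE snd_tupleE.
by rewrite -[\1_C (Z w)]/(\1_(Z @^-1` C) w : R); ring.
Qed.

(** The kernel given [X] is also a kernel given [W]: conditional independence verifies this on
    rectangles, which generate the product sigma-algebra. *)
Lemma cond_independent_eq_ccx : cond_independent Y Z X -> eq_ccx Y X Y W.
Proof.
move=> YZ; split; first exact: ccx_cat.
apply: ccx_kernels => v v01; set E := mkset _.
have mE : measurable E := measurable_quantile_event Y v.
have bE := bmf_indic R mE.
have [f kf] := cond_kernel_exists X mE; have bf := cond_kernel_bmf kf.
have bfX := bmf_RV X bf.
exists (fun x => f (fst_tuple x)), f; split => //; last first.
  by move=> phi _; rewrite le_eqVlt; apply/orP; left; apply/eqP/mean_eq => w; rewrite fst_tupleE.
have [mf f01 _] := kf; split.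
- exact: measurableT_comp mf measurable_fst_tuple.
- by move=> x; exact: f01.
move=> G mG.
pose XZ w := (X w, Z w).
have mXZ : measurable_fun setT XZ.
  by apply/measurable_fun_pairP; split; exact: measurable_funPT.
(* Sets of concatenated tuples are pulled back to pairs, where rectangles form a generating class
   stable under intersection. *)
pose G' := (fun x : p.-tuple R * q.-tuple R =>
  [tuple of x.1 ++ x.2] : (p + q).-tuple R) @^-1` G.
have mG' : measurable G' by rewrite -[G']setTI; exact: measurable_cat.
have bh : bmf (fun w => f (X w) - \1_E w) by exact: bmfB.
suff : mean P (fun w => \1_(XZ @^-1` G') w * (f (X w) - \1_E w)) = 0.
  have bG : bmf (\1_(XZ @^-1` G') : T -> R).
    by apply: bmf_indic; rewrite -[X in measurable X]setTI; exact: mXZ.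
  rewrite (@mean_eq _ _ _ _ _ (fun w =>
      \1_(XZ @^-1` G') w * f (X w) - \1_(XZ @^-1` G') w * \1_E w)).
    rewrite meanB; [|exact: bmfM|exact: bmfM].
    move=> /eqP; rewrite subr_eq0 => /eqP fE.
    by under mean_eq do rewrite fst_tupleE.
  by move=> w; rewrite mulrBr.
apply: (@mean_preimage_dynkin _ _ _ _ _ _ _ _ _ _
  [set A `*` B | A in @measurable _ (p.-tuple R) & B in @measurable _ (q.-tuple R)])
  mG' => //.
- exact: measurable_prod_measurableType.
- move=> _ _ [A mA [B mB <-]] [A' mA' [B' mB' <-]].
  exists (A `&` A'); first exact: measurableI.
  by exists (B `&` B'); [exact: measurableI|rewrite setXI].
- by rewrite meanB ?mean_indic ?(cond_kernel_meanE mE kf) ?subrr.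
move=> _ [D mD [C mC <-]].
have bD := bmf_indic R mD; have mZC := measurable_preimage_RV Z mC.
have bC := bmf_indic R mZC; have bDX := bmf_RV X bD.
have [g kg] := cond_kernel_exists X mZC; have bg := cond_kernel_bmf kg.
have mEC := measurableI _ _ mE mZC.
have [r kr] := cond_kernel_exists X mEC; have br := cond_kernel_bmf kr.
have bgX := bmf_RV X bg; have brX := bmf_RV X br.
have rfg : {ae P, forall w, r (X w) = f (X w) * g (X w)}.
  have EY : E = Y @^-1` `[quantile Y v, +oo[.
    by apply/seteqP; split => w /=; rewrite in_itv/= andbT.
  have := cond_kernel_is_cond_prob mEC kr; have := cond_kernel_is_cond_prob mE kf.
  rewrite EY => vf vr.
  exact: (YZ _ _ (measurable_itv _) mC _ _ _ vf (cond_kernel_is_cond_prob mZC kg) vr).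
have bDf : bmf (fun x => \1_D x * f x) by exact: bmfM.
rewrite (@mean_eq _ _ _ _ _ (fun w =>
    (\1_D (X w) * f (X w)) * \1_(Z @^-1` C) w - \1_D (X w) * \1_(E `&` Z @^-1` C) w)).
  have bDfX := bmf_RV X bDf; have bEC := bmf_indic R mEC.
  rewrite meanB; [|exact: bmfM|exact: bmfM].
  rewrite -(cond_kernel_mean mZC kg bDf) -(cond_kernel_mean mEC kr bD).
  apply/eqP; rewrite subr_eq0; apply/eqP; apply: ae_mean_eq.
  - exact: bmfM.
  - exact: bmfM.
  - by apply: filterS rfg => w ->; rewrite mulrA.
move=> w; rewrite (_ : XZ @^-1` (D `*` C) = X @^-1` D `&` Z @^-1` C)//.
rewrite !indicI/= -[\1_D (X w)]/(\1_(X @^-1` D) w : R); ring.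
Qed.

End conditional_independence.

(** * Monotone and distribution function transformations *)

Section monotone_transformations.
Context d (T : measurableType d) (R : realType) (P : probability T R).

Lemma quantile_event_comp_mono (g : R -> R) (mg : measurable_fun setT g)
    (Y : {RV P >-> R}) v : {mono g : x y / x <= y} -> 0 < v < 1 ->
  [set w | quantile (comp_RV mg Y) v <= comp_RV mg Y w] =
  [set w | quantile Y v <= Y w].
Proof.
move=> gm; apply: cdfR_comp_quantile_event => y; rewrite /cdfR; congr fine.
rewrite /cdf /distribution /pushforward; congr (P _).
by apply/seteqP; split => w /=; rewrite !in_itv/= gm.
Qed.

(** Although the distribution function may have flat pieces, [cdfR Y (Y w) <= cdfR Y y] and
    [Y w <= y] differ only on a null event. *)
Lemma quantile_event_cdfR (Y : {RV P >-> R}) v : 0 < v < 1 ->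
  [set w | quantile (comp_RV (measurable_cdfR Y) Y) v <= comp_RV (measurable_cdfR Y) Y w] =
  [set w | quantile Y v <= Y w].
Proof.
apply: cdfR_comp_quantile_event => y; rewrite /cdfR; congr fine.
rewrite /cdf /distribution /pushforward; apply: ae_prob_eq.
- exact: measurable_preimage_RV.
- exact: measurable_preimage_RV.
apply: filterS (ae_cdfR_gt Y y) => w Fy; rewrite /= !in_itv/= !leNgt.
by split; apply: contraNN => /Fy.
Qed.

(** By [ae_cdfR_gt], each ray of a coordinate is almost surely a ray of the transformed
    coordinate. *)
Lemma ae_cdf_tuple_inverse p (X : {RV P >-> p.-tuple R}) :
  exists2 k : p.-tuple R -> p.-tuple R, measurable_fun setT k &
    {ae P, forall w, X w = k (comp_RV (measurable_cdf_tuple X) X w)}.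
Proof.
apply: ae_factor_tuple => i y.
exists ((@tnth p R)^~ i @^-1` `]cdfR (coord_RV X i) y, +oo[).
  by rewrite -[X in measurable X]setTI; exact: measurable_tnth.
have := ae_cdfR_gt (coord_RV X i) y; apply: filterS => w.
by rewrite /= tnth_mktuple in_itv/= andbT.
Qed.

End monotone_transformations.

(** * Coding tuples by single real numbers *)

Section ternary_code.
Context (R : realType).
Implicit Type c : nat -> bool.

Let partial c (n : nat) : R := \sum_(i < n) (c i)%:R / 3 ^+ i.

(** A Cantor-type code: digits 0 and 1 in base 3 leave gaps that make the expansion unique, unlike
    in base 2. *)
Definition ternary c : R := limn (partial c).

Let partialS c n : partial c n.+1 = (c 0%N)%:R + partial (fun i => c i.+1) n / 3.
Proof.
rewrite /partial big_ord_recl/= expr0 divr1 mulr_suml; congr (_ + _).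
by apply: eq_bigr => i _; rewrite /bump/= add1n exprSr invfM mulrA.
Qed.

Let partial_ge0 c n : 0 <= partial c n.
Proof. by apply: sumr_ge0 => i _; rewrite divr_ge0// exprn_ge0. Qed.

Let partial_le c n : partial c n <= 3 / 2.
Proof.
elim: n c => [|n IH] c; first by rewrite /partial big_ord0 divr_ge0.
rewrite partialS; have := IH (fun i => c i.+1).
by case: (c 0%N) => /= h; lra.
Qed.

Let partial_cvg c : partial c @ \oo --> ternary c.
Proof.
apply: nondecreasing_is_cvgn.
  apply/nondecreasing_seqP => n; rewrite /partial big_ord_recr/= lerDl.
  by rewrite divr_ge0// exprn_ge0.
by exists (3 / 2) => _ [n _ <-]; exact: partial_le.
Qed.

Let ternary_itv c : 0 <= ternary c <= 3 / 2.
Proof.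
have cvgc : cvgn (partial c) by apply/cvg_ex; eexists; exact: partial_cvg.
apply/andP; split.
  by apply: limr_ge => //; apply: nearW => n; exact: partial_ge0.
by apply: limr_le => //; apply: nearW => n; exact: partial_le.
Qed.

Let ternaryS c : ternary c = (c 0%N)%:R + ternary (fun i => c i.+1) / 3.
Proof.
have h1 : (fun n => partial c n.+1) @ \oo --> ternary c.
  by rewrite (cvg_shiftS (partial c)); exact: partial_cvg.
rewrite -(cvg_lim _ h1)//; apply: cvg_lim => //.
under eq_fun do rewrite partialS.
apply: cvgD; first exact: cvg_cst.
by apply: cvgMl; exact: partial_cvg.
Qed.

Lemma measurable_ternary d (T : measurableType d) (c : T -> nat -> bool) :
  (forall n, measurable [set x | c x n]) ->
  measurable_fun [set: T] (fun x => ternary (c x)).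
Proof.
move=> mc; apply: (@measurable_fun_cvg _ _ _ _ (fun n x => partial (c x) n)).
  move=> n; apply: measurable_sum => i; apply: measurable_funM => //.
  rewrite (_ : (fun _ => _) = \1_[set x | c x i]); first exact: measurable_indic.
  apply/funext => x; rewrite indicE; congr (_%:R); congr nat_of_bool.
  by apply/idP/idP => [/mem_set//|/set_mem].
by move=> x _; exact: partial_cvg.
Qed.

(* Since the digits after the first contribute at most [1 / 2], the first digit
   is [1] iff the value is at least [1]. *)
Fixpoint digit (n : nat) (z : R) : bool :=
  if n is n'.+1 then digit n' (3 * (z - (1 <= z)%R%:R)) else 1 <= z.

Lemma digit_ternary c n : digit n (ternary c) = c n.
Proof.
have first c' : (1 <= ternary c') = c' 0%N.
  have := ternary_itv (fun i => c' i.+1); rewrite [ternary c']ternaryS.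
  move=> /andP[h0 h1].
  case: (c' 0%N).
    by apply/idP; rewrite -[true%:R]/(1 : R); lra.
  by apply/negbTE; rewrite -ltNge -[false%:R]/(0 : R); lra.
elim: n c => [|n IH] c //=; rewrite first [ternary c]ternaryS addrC addKr.
by rewrite mulrC divfK// IH.
Qed.

Lemma measurable_digit n : measurable_fun [set: R] (digit n).
Proof.
have m0 : measurable_fun [set: R] (fun z : R => 1 <= z) by exact: measurable_fun_ler.
elim: n => //= n IH; apply: measurableT_comp => //.
apply: measurable_funM => //; apply: measurable_funB => //.
rewrite (_ : (fun _ => _) = \1_(`[1, +oo[%classic : set R)).
  exact: measurable_indic.
apply/funext => z; rewrite indicE; congr (_%:R); congr nat_of_bool.
by apply/idP/idP => [z1|/set_mem]; [apply/mem_set|]; rewrite /= in_itv/= andbT.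
Qed.

End ternary_code.

(** The digits list the rational cuts of all coordinates, with the pair of a coordinate and a
    rational index packed into one position; decoding reads the digits and applies [cut_sup]. *)
Lemma tuple_code (R : realType) p :
  exists (c : p.-tuple R -> R) (k : R -> p.-tuple R),
    [/\ measurable_fun setT c, measurable_fun setT k & cancel c k].
Proof.
pose bits (x : p.-tuple R) n :=
  if unpickle n is Some (i, l) then ratseq R l < tnth x (i : 'I_p) else false.
exists (fun x => ternary R (bits x)).
exists (fun z => [tuple cut_sup R (fun l => digit (pickle (i, l)) z) | i < p]).
split.
- apply: measurable_ternary => n; rewrite /bits.
  case: unpickle => [[i l]|]; last by rewrite (_ : mkset _ = set0)//; apply/seteqP; split.
  rewrite (_ : mkset _ = (@tnth p R)^~ i @^-1` `]ratseq R l, +oo[).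
    by rewrite -[X in measurable X]setTI; exact: measurable_tnth.
  by apply/seteqP; split => x /=; rewrite in_itv/= andbT.
- apply/measurable_fun_tnthP => i.
  rewrite (_ : _ \o _ = fun z => cut_sup R (fun l => digit (pickle (i, l)) z)).
    apply: (@measurable_cut_sup _ _ _ (fun z l => digit (pickle (i, l)) z)) => l.
    have := @measurable_digit R (pickle (i, l)) measurableT [set true].
    by rewrite setTI; exact.
  by apply/funext => z /=; rewrite tnth_mktuple.
- move=> x; apply: eq_from_tnth => i; rewrite tnth_mktuple -[RHS]cut_supE.
  by congr cut_sup; apply/funext => l; rewrite digit_ternary /bits pickleK.
Qed.

(** * Representing a law by a function of a uniform variable *)

Section skorokhod.
Context d (T : measurableType d) (R : realType) (P : probability T R).

Let Q : probability (measurableTypeR R) R := uniform_prob (@ltr01 R).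

Lemma uniform01_prob (A : set R) : measurable A ->
  uniform_prob (@ltr01 R) A = lebesgue_measure (A `&` `[0, 1]).
Proof.
move=> mA; rewrite -[in LHS](setIT A) -(integral_indic Q measurableT mA).
rewrite integral_uniform//; last exact/measurable_EFinP/measurable_indic.
by rewrite subr0 invr1 mul1e integral_indic.
Qed.

(** The quantile function, set to 0 outside (0, 1), works: by the Galois connection [r u > y] means
    [u > cdfR U y] there, and rays determine a law. *)
Lemma skorokhod (U : {RV P >-> R}) : exists2 r : R -> R,
  measurable_fun [set: R] r &
  forall B, measurable B -> uniform_prob (@ltr01 R) (r @^-1` B) = P (U @^-1` B).
Proof.
pose r := quantile U \_ (`]0, 1[ : set R).
have rE u : 0 < u < 1 -> r u = quantile U u.
  by move=> u01; rewrite /r patchE mem_set//= in_itv.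
have mr : measurable_fun [set: R] r.
  apply: (measurable_restrictT (quantile U) (measurable_itv `]0, 1[)).1.
  apply: (measurability _ (RGenOInfty.measurableE R)) => _ /= -[_ [y ->] <-].
  rewrite (_ : _ `&` _ = `]0, 1[ `&` `]cdfR U y, +oo[); first exact: measurableI.
  apply/seteqP; split => u /= []; rewrite !in_itv/= !andbT => u01.
    by rewrite ltNge quantile_le// -ltNge.
  by move=> Fu; split => //; rewrite ltNge quantile_le// -ltNge.
exists r => // B mB.
have mr' : @measurable_fun _ _ (measurableTypeR R) R setT r := mr.
pose r' : {RV Q >-> R} := HB.pack r (isMeasurableFun.Build _ _ (measurableTypeR R) R r mr').
rewrite -[LHS]/(distribution Q r' B) -[RHS]/(distribution P U B).
apply: (@measure_unique _ _ _ (@RGenOInfty.G R)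
  (fun n : nat => `]- n%:R, +oo[%classic) _ _ _ _ (distribution Q r') (distribution P U)) => //.
- exact: RGenOInfty.measurableE.
- move=> _ _ [x ->] [y ->]; exists (Num.max x y).
  by apply/seteqP; split => z; rewrite /= !in_itv/= !andbT gt_max => /andP.
- by move=> n; exists (- n%:R).
- apply/seteqP; split => // x _; exists (Num.trunc (- x)).+1 => //=.
  by rewrite in_itv/= andbT ltrNl truncnS_gt.
- move=> _ [y ->].
  have mS : measurable (r @^-1` `]y, +oo[) by rewrite -[X in measurable X]setTI; exact: mr.
  rewrite /distribution/pushforward [LHS]uniform01_prob//.
  have PU : P (U @^-1` `]y, +oo[) = (1 - cdfR U y)%:E.
    rewrite -prob_gt; congr (P _).
    by apply/seteqP; split => w /=; rewrite in_itv/= andbT.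
  rewrite [RHS]PU.
  have /andP[F0 F1] := cdfR01 U y.
  have mS1 : measurable (r @^-1` `]y, +oo[ `&` `[0, 1]) by exact: measurableI.
  apply/eqP; rewrite eq_le; apply/andP; split.
    (* At [u = 0] the value of [r] is the default one and may exceed [y], hence the additional null
       point. *)
    apply: (@le_trans _ _ (lebesgue_measure (`[cdfR U y, 1] `|` [set 0 : R]))).
      apply: le_measure; rewrite ?inE//; first exact: measurableU.
      move=> u []; rewrite /= !in_itv/= !andbT => yr /andP[].
      rewrite le_eqVlt => /orP[/eqP <-|u0 u1]; [by right|left].
      rewrite u1 andbT; move: u1; rewrite le_eqVlt => /orP[/eqP ->//|u1].
      by rewrite ltW// ltNge -quantile_le ?u0// -rE ?u0// -ltNge.
    apply: le_trans (measureU2 _ _ _) _ => //.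
    rewrite [X in (_ + X)%E]lebesgue_measure_set1 adde0 [leLHS]lebesgue_measure_itv/= lte_fin.
    by case: ifPn => // _; rewrite lee_fin subr_ge0.
  apply: (@le_trans _ _ (lebesgue_measure (`]cdfR U y, 1[ : set R))).
    rewrite lebesgue_measure_itv/= lte_fin.
    case: ifPn; first by rewrite EFinB.
    by rewrite -leNgt => F1'; rewrite lee_fin subr_le0.
  apply: le_measure; rewrite ?inE// => u; rewrite /= !in_itv/= andbT => /andP[Fu u1].
  have u0 : 0 < u by exact: le_lt_trans Fu.
  split; last by rewrite !ltW.
  by rewrite rE ?u0// ltNge quantile_le ?u0// -ltNge.
- by move=> n; rewrite ltey_eq fin_num_measure.
Qed.

End skorokhod.

(** * Almost sure Borel inverses of injective maps *)

Section injective_borel.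
Context d (T : measurableType d) (R : realType) (P : probability T R).

(* Lusin-Souslin modulo null sets.  [X] has the law of a Borel function [r] of a
   uniform variable; by Lusin's theorem [h \o r] (coded in [R]) is continuous on
   a compact set [K] of almost full measure in [r @^-1` B], and the image of [K]
   is compact, hence Borel. *)
Lemma injective_image_approx p q (X : {RV P >-> p.-tuple R})
    (h : p.-tuple R -> q.-tuple R) (B : set (p.-tuple R)) (e : R) :
  measurable_fun [set: p.-tuple R] h -> injective h -> measurable B -> 0 < e ->
  exists C : set (q.-tuple R), [/\ measurable C, h @^-1` C `<=` B &
    (P (X @^-1` (B `\` h @^-1` C)) < e%:E)%E].
Proof.
move=> mh hI mB e0.
have [cp [kp [mcp mkp cpK]]] := tuple_code R p.
have [cq [kq [mcq mkq cqK]]] := tuple_code R q.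
have [r0 mr0 r0E] := skorokhod (comp_RV mcp X).
pose r u := kp (r0 u).
have mr : measurable_fun setT r by exact: measurableT_comp mkp mr0.
have rE D : measurable D -> uniform_prob (@ltr01 R) (r @^-1` D) = P (X @^-1` D).
  move=> mD; rewrite -[r @^-1` D]/(r0 @^-1` (kp @^-1` D)) r0E; last first.
    by rewrite -[X in measurable X]setTI; exact: mkp.
  by congr (P _); apply/seteqP; split => w /=; rewrite cpK.
pose f u := cq (h (r u)).
have mf : measurable_fun setT f.
  by apply: measurableT_comp => //; apply: measurableT_comp.
pose A := r @^-1` B `&` `[0, 1].
have mA : measurable A.
  by apply: measurableI => //; rewrite -[X in measurable X]setTI; exact: mr.
have Afin : (lebesgue_measure A < +oo)%E.
  apply: (@le_lt_trans _ _ (lebesgue_measure (`[0, 1] : set R))).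
    by apply: le_measure; rewrite ?inE//; exact: subIsetr.
  by rewrite lebesgue_measure_itv/= lte_fin ltr01 sube0 ltry.
have [K [cK KA AK fK]] := measurable_almost_continuous mA Afin e0 (measurable_funTS mf).
have mK : measurable K.
  by apply: closed_measurable; apply: compact_closed => //; exact: Rhausdorff.
have mfK : measurable (f @` K).
  apply: closed_measurable; apply: compact_closed; first exact: Rhausdorff.
  exact: continuous_compact.
pose C := cq @^-1` (f @` K).
have mC : measurable C by rewrite -[C]setTI; exact: mcq.
exists C; split => //.
  (* Injectivity of [h] and of the code identifies [x] with [r u], where [u] in [K] lies in the
     preimage of [B]. *)
  move=> x [u Ku /(can_inj cqK)/hI <-].
  by have [] := KA _ Ku.
have mD : measurable (B `\` h @^-1` C).
  by apply: measurableD => //; rewrite -[X in measurable X]setTI; exact: mh.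
rewrite -rE// uniform01_prob; last by rewrite -[X in measurable X]setTI; exact: mr.
apply: le_lt_trans AK; apply: le_measure; rewrite ?inE.
- by apply: measurableI => //; rewrite -[X in measurable X]setTI; exact: mr.
- exact: measurableD.
- by move=> u [[Bu Cu] u01]; split => // Ku; apply: Cu; exists u.
Qed.

(** The union of the approximations with errors [1/(n+1)] has its preimage inside [B] and misses
    only a null part of it, so each ray of a coordinate of [X] is almost surely an event of
    [h(X)]. *)
Lemma injective_ae_inverse p q (X : {RV P >-> p.-tuple R})
    (h : p.-tuple R -> q.-tuple R) :
  measurable_fun [set: p.-tuple R] h -> injective h ->
  exists2 k : q.-tuple R -> p.-tuple R, measurable_fun [set: q.-tuple R] k &
    {ae P, forall w, X w = k (h (X w))}.
Proof.
move=> mh hI; apply: ae_factor_tuple => i y.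
pose B := (@tnth p R)^~ i @^-1` `]y, +oo[.
have mB : measurable B by rewrite -[B]setTI; exact: measurable_tnth.
have /choice[C CP] n : exists C : set (q.-tuple R), [/\ measurable C, h @^-1` C `<=` B &
    (P (X @^-1` (B `\` h @^-1` C)) < (n.+1%:R^-1)%:E)%E].
  by apply: injective_image_approx => //; rewrite invr_gt0.
exists (\bigcup_n C n); first by apply: bigcup_measurable => n _; case: (CP n).
have mN (D : set (q.-tuple R)) : measurable D -> measurable (X @^-1` (B `\` h @^-1` D)).
  move=> mD; apply: measurable_preimage_RV; apply: measurableD => //.
  by rewrite -[X in measurable X]setTI; exact: mh.
exists (X @^-1` (B `\` h @^-1` \bigcup_n C n)); split.
- by apply: mN; apply: bigcup_measurable => n _; case: (CP n).
- apply/eqP; rewrite eq_le measure_ge0 andbT.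
  apply/lee_addgt0Pr => e e0; rewrite add0e.
  have [n] := ltr_add_invr e0; rewrite add0r => ne.
  have [mC _ PC] := CP n.
  apply: (@le_trans _ _ (n.+1%:R^-1)%:E); last by rewrite lee_fin ltW.
  apply: le_trans (ltW PC); apply: le_measure; rewrite ?inE.
  + by apply: mN; apply: bigcup_measurable => k _; case: (CP k).
  + exact: mN.
  + by move=> w [Bw nC]; split => // Cw; apply: nC; exists n.
- move=> w /= nE; apply: contrapT => /= nN; apply: nE; split=> [yw|[n _ Cw]].
    apply: contrapT => nC; apply: nN; split => //.
    by rewrite /B/= in_itv/= andbT.
  have [_ CB _] := CP n; have := CB _ Cw.
  by rewrite /B/= in_itv/= andbT.
Qed.

End injective_borel.

(** * The eight properties of the order *)

Theorem theorem1p4 (R : realType) (d : measure_display) (T : measurableType d)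
    (P : probability T R) (P_nonatomic : nonatomic P)
    (A : set R) (A_closed : closed A) (A01 : A `<=` `[0, 1]) :
  (* O1 *)
  (forall p (Y : {RV P >-> R}) (X : {RV P >-> p.-tuple R})
      (Y' : {RV P >-> R}) (X' : {RV P >-> p.-tuple R}),
    in_RA A Y X -> in_RA A Y' X' ->
    eq_dist Y X Y' X' -> eq_ccx Y X Y' X')
  /\
  (* O2 *)
  ((forall p (Y : {RV P >-> R}) (X : {RV P >-> p.-tuple R}),
     in_RA A Y X -> ccx Y X Y X)
   /\
   (forall p1 p2 p3 (Y1 Y2 Y3 : {RV P >-> R}) (X1 : {RV P >-> p1.-tuple R})
       (X2 : {RV P >-> p2.-tuple R}) (X3 : {RV P >-> p3.-tuple R}),
     in_RA A Y1 X1 -> in_RA A Y2 X2 -> in_RA A Y3 X3 ->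
     ccx Y1 X1 Y2 X2 -> ccx Y2 X2 Y3 X3 -> ccx Y1 X1 Y3 X3))
  /\
  (* O3 *)
  (forall p (Y : {RV P >-> R}) (X : {RV P >-> p.-tuple R}), in_RA A Y X ->
    ((forall p' (Y' : {RV P >-> R}) (X' : {RV P >-> p'.-tuple R}),
        in_RA A Y' X' -> ccx Y X Y' X')
     <-> independent X Y))
  /\
  (* O4 *)
  (forall p (Y : {RV P >-> R}) (X : {RV P >-> p.-tuple R}), in_RA A Y X ->
    ((forall p' (Y' : {RV P >-> R}) (X' : {RV P >-> p'.-tuple R}),
        in_RA A Y' X' -> ccx Y' X' Y X)
     <-> perfectly_dependent Y X))
  /\
  (* O5 *)
  (forall p q (Y : {RV P >-> R}) (X : {RV P >-> p.-tuple R})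
      (Z : {RV P >-> q.-tuple R}),
    (0 < q)%N -> in_RA A Y X -> in_RA A Y (cat_RV X Z) ->
    ccx Y X Y (cat_RV X Z))
  /\
  (* O6 *)
  (forall p q (Y : {RV P >-> R}) (X : {RV P >-> p.-tuple R})
      (Z : {RV P >-> q.-tuple R}),
    (0 < q)%N -> in_RA A Y X -> in_RA A Y (cat_RV X Z) ->
    (eq_ccx Y X Y (cat_RV X Z) <-> cond_independent Y Z X))
  /\
  (* O7 *)
  (forall p q (Y : {RV P >-> R}) (X : {RV P >-> p.-tuple R})
      (g : R -> R) (g_incr : strictly_increasing g)
      (h : p.-tuple R -> q.-tuple R) (mh : measurable_fun setT h),
    bijective h -> in_RA A Y X ->
    eq_ccx Y X (comp_RV (strictly_increasing_measurable g_incr) Y)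
      (comp_RV mh X))
  /\
  (* O8 *)
  (forall p (Y : {RV P >-> R}) (X : {RV P >-> p.-tuple R}), in_RA A Y X ->
    eq_ccx Y X (comp_RV (measurable_cdfR Y) Y) X
    /\ eq_ccx Y X Y (comp_RV (measurable_cdf_tuple X) X)).
Proof.
split; [|split; [|split; [|split; [|split; [|split; [|split]]]]]].
- move=> p Y X Y' X' _ _ YX; split; apply: eq_dist_ccx => // B mB.
  by rewrite YX.
- split; first by move=> *; exact: ccx_refl.
  by move=> p1 p2 p3 Y1 Y2 Y3 X1 X2 X3 _ _ _; exact: ccx_trans.
- move=> p Y X YA; split; first exact: minimal_independent.
  by move=> XY p' Y' X' YA'; exact: ccx_minimal YA YA' XY.
- move=> p Y X YA; split; first exact: maximal_perfectly_dependent.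
  by move=> YX p' Y' X' YA'; exact: ccx_maximal YA YA' YX.
- by move=> *; exact: ccx_cat.
- move=> p q Y X Z _ _ _; split; first exact: eq_ccx_cond_independent.
  exact: cond_independent_eq_ccx.
- move=> p q Y X g g_incr h mh hbij _; have gm := le_mono g_incr.
  (* The vectors [X] and [h(X)] are functions of each other, in one direction only almost surely, so
     conditional Jensen applies both ways. *)
  have [k mk Xk] := injective_ae_inverse X mh (bij_inj hbij).
  split.
    apply: (@ccx_factor _ _ _ _ _ _ _ _ X (comp_RV mh X) k) => // v v01.
    by rewrite quantile_event_comp_mono.
  apply: (@ccx_factor _ _ _ _ _ _ _ _ (comp_RV mh X) X h) => // [v v01|]; last exact: aeW.
  by rewrite quantile_event_comp_mono.
- move=> p Y X _; split; last first.
    have [k mk Xk] := ae_cdf_tuple_inverse X; split.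
      exact: (@ccx_factor _ _ _ _ _ _ _ _ X (comp_RV (measurable_cdf_tuple X) X) k).
    by apply: (@ccx_factor _ _ _ _ _ _ _ _ (comp_RV (measurable_cdf_tuple X) X) X
      (cdf_tuple X)) => //; [exact: measurable_cdf_tuple|exact: aeW].
  split; apply: (@ccx_factor _ _ _ _ _ _ _ _ X X id) => // [v v01|].
  - by rewrite quantile_event_cdfR.
  - exact: aeW.
  - by rewrite quantile_event_cdfR.
  - exact: aeW.
Qed.
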